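(* Let $R(w)=r_nw^n+\ldots+r_1w+r_0\in\mathbb{Z}[w]$ be a polynomial with leading coefficient $r_n>0$, let $R_0(w)$ denote the square-free part of $R(w)$, let $\Delta_R:=\operatorname{res}_w(R_0(w),R_0'(w))$, and suppose that the maximal modulus of the complex roots of $R(w)$ is bounded by $B\in\mathbb{R}$. Let $\delta(\Delta_R):=\prod_{p\mid\Delta_R}p^{1/(p-1)}$ (product over the prime divisors $p$ of $\Delta_R$) and set $$M:=\left\lceil 2.826\cdot r_n^3\cdot\delta(\Delta_R)^3\right\rceil,\qquad N:=\lceil 6.076\cdot BM\rceil,\qquad \sigma:=(2M+1)N+2M.$$ Then $R(w)$ splits into linear factors in $\mathbb{Q}[w]$ if and only if, for every prime number $p$ not dividing $r_n$ and less than $\sigma$, the reduction of $R(w)$ modulo $p$ splits into linear factors in $\mathbb{F}_p[w]$.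
   Context: $\operatorname{res}_w$ denotes the resultant with respect to $w$. The square-free part of $R(w)$ is $R_0(w)=R(w)/\gcd(R(w),R'(w))$, normalized to lie in $\mathbb{Z}[w]$ (gcd taken in $\mathbb{Z}[w]$). *)

(* Defs.v *)
From HB Require Import structures.
From mathcomp Require Import all_boot all_order all_algebra.
From mathcomp Require Import all_classical all_reals all_analysis.
From mathcomp Require Import complex.

Set Implicit Arguments.
Unset Strict Implicit.
Unset Printing Implicit Defensive.

Import Order.TTheory GRing.Theory Num.Theory.
Local Open Scope ring_scope.

(* The library's [D %| P] on {poly int} is pseudo-divisibility, i.e. it means
   divisibility in Q[w]; the contents matter here. *)
Definition zpoly_dvd (D P : {poly int}) : Prop :=
  exists Q : {poly int}, P = Q * D.

Definition is_zpoly_gcd (G P Q : {poly int}) : Prop :=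
  [/\ zpoly_dvd G P, zpoly_dvd G Q
    & forall D, zpoly_dvd D P -> zpoly_dvd D Q -> zpoly_dvd D G].

(* A gcd in Z[w] is defined up to sign, hence so is the square-free part. *)
Definition is_squarefree_part (R0 R : {poly int}) : Prop :=
  exists2 G : {poly int}, is_zpoly_gcd G R R^`() & R = R0 * G.

(* Intended for P != 0; the empty list covers nonzero constants. *)
Definition splits (F : fieldType) (P : {poly F}) : Prop :=
  exists rs : seq F, P %= \prod_(z <- rs) ('X - z%:P).

Definition delta (K : realType) (m : int) : K :=
  \prod_(p <- primes `|m|%N) (p%:R `^ (p%:R - 1)^-1).

Lemma zpoly_dvdE (D P : {poly int}) : D != 0 ->
  zpoly_dvd D P <-> (zcontents D %| zcontents P)%Z /\ D %| P.
Proof.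
move=> D0; split=> [[Q ->]|[/dvdzP[k Dk] /dvdpP_int[r Dr]]].
  by rewrite zcontentsM dvdz_mull // dvdp_mull.
exists (k *: zprimitive r).
have zr : zcontents r = k * zcontents D.
  by rewrite -Dk Dr zcontentsM zcontents_primitive D0 mul1r.
rewrite -scalerAl {1}[D]zpolyEprim -scalerAr scalerA -zr.
by rewrite mulrC {1}Dr {1}[r]zpolyEprim -scalerAr.
Qed.

Lemma zpoly_gcd_exists (P Q : {poly int}) : P != 0 ->
  exists G, is_zpoly_gcd G P Q.
Proof.
move=> P0; set c := gcdz (zcontents P) (zcontents Q).
have c0 : c != 0 by rewrite gcdz_eq0 zcontents_eq0 (negbTE P0).
have g0 : gcdp P Q != 0 by rewrite gcdp_eq0 (negbTE P0).
have G0 : c *: zprimitive (gcdp P Q) != 0.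
  by rewrite -mul_polyC mulf_neq0 ?polyC_eq0 ?zprimitive_eq0.
have zG : zcontents (c *: zprimitive (gcdp P Q)) = c.
  by rewrite zcontentsZ zcontents_primitive g0 mulr1.
have eqG : c *: zprimitive (gcdp P Q) %= gcdp P Q.
  rewrite {2}[gcdp P Q]zpolyEprim.
  apply: eqp_trans (eqp_scale _ c0) _; rewrite eqp_sym.
  by apply: eqp_scale; rewrite zcontents_eq0.
exists (c *: zprimitive (gcdp P Q)); split.
- by apply/(zpoly_dvdE _ G0); rewrite zG dvdz_gcdl (eqp_dvdl _ eqG) dvdp_gcdl.
- by apply/(zpoly_dvdE _ G0); rewrite zG dvdz_gcdr (eqp_dvdl _ eqG) dvdp_gcdr.
move=> D DP DQ; have D0 : D != 0.
  by apply: contraNneq P0 => D0; case: DP => S ->; rewrite D0 mulr0.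
move: DP DQ => /(zpoly_dvdE _ D0)[cP dP] /(zpoly_dvdE _ D0)[cQ dQ].
by apply/(zpoly_dvdE _ D0); rewrite zG dvdz_gcd cP cQ (eqp_dvdr _ eqG) dvdp_gcd dP dQ.
Qed.

Lemma squarefree_part_exists (R : {poly int}) : R != 0 ->
  exists R0, is_squarefree_part R0 R.
Proof.
move=> /(@zpoly_gcd_exists _ R^`())[G GP].
by case: (GP) => -[R0 DR] _ _; exists R0, G.
Qed.

(* Main.v *)
Require Import Defs.
From HB Require Import structures.
From mathcomp Require Import all_boot all_order all_algebra.
From mathcomp Require Import separable algC.
From mathcomp Require Import all_classical all_reals all_analysis.
From mathcomp Require Import complex.
From mathcomp Require Import zify ring lra.
Set Implicit Arguments.
Unset Strict Implicit.
Unset Printing Implicit Defensive.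
Import Order.TTheory GRing.Theory Num.Theory.

(** The forward implication is Gauss's lemma: a polynomial that splits over Q is
a product of linear factors over Z, and these stay linear modulo every prime
that does not divide the leading coefficient.

For the converse, suppose that R does not split over Q.  Every root of R is a
simple root of R0 ([squarefree_part_simple_roots]), so R0 does not split either
and has a factor f in Z[w] of degree d > 1 without rational roots
([linear_factors_or_no_root]).  Write m, n for the integers M, N of the theorem
and let z run over the complex roots of f.  The proof confronts two estimates
of one nonzero integer, following the Hermite-Pade approximation of the powers
(1 - x)^(j z), 0 <= j <= 2 m, by polynomials of degree n.

- Divisibility.  The coefficients of these approximants are the inverses of the
  products of differences between the nodes j z + h, with 0 <= j <= 2 m and
  0 <= h <= n, which are pairwise distinct when z is irrational.  There are
  sigma + 1 nodes, so when z is replaced by an integer b > n, Lagrange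
  interpolation at the nodes shows that sigma! divides every common multiple of
  those products of differences ([fact_dvd_common_multiple]).  With P_k(b) the
  product of the k b + t over |t| <= n, and L a common multiple of the binomial
  coefficients 'C(n, h), one common multiple is
    F(b) = L^(2 m) n! (prod_(k <= m) P_k(b)) (prod_(k <= 2 m) P_k(b)),
  and since blocks of consecutive integers are themselves divisible by
  factorials, F(b) is even divisible by sigma! n!^(2 m) (2 n + 1)!^m
  ([fact_dvd_blocks]).  Moreover L <= 4^n is possible ([bin_common_multiple]).

- Transfer to the roots of f.  If f splits into distinct linear factors modulo
  p, then by Hensel's lemma it has integer roots modulo any power of p.
  Therefore the norm of F(z), an integer once multiplied by a power of the
  leading coefficient of f, contains the d-th power of the p-part of the above
  factorials ([pexp_dvd_aux_norm]).  This applies to all the primes below sigma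
  that divide neither r_n nor Delta_R; the factorial sigma! is lowered
  to (sigma - 1)! so that only primes below sigma occur.  The part of the
  factorials at the remaining primes is controlled by r_n and delta
  ([bad_primes_bound]), as the exponent of p in k! is at most k / (p - 1).

- Size.  The factors of P_k(z) pair off into k^2 z^2 - t^2, so that
  |P_k(z)| <= k B n!^2 exp (4 k B) ([norm_ring_block_le]).  The choice of M and
  N makes the resulting bound on F smaller than the good part of the factorials
  ([size_estimate]): the multinomial coefficient hidden in sigma! contributes
  about (2 m)^(2 m n), which beats (r_n delta)^(6 m n) times an explicit
  constant to the power m n because m >= 2.826 (r_n delta)^3.

So the norm of F(z) is 0.  But it is a nonzero multiple of a product of values
of f at rational numbers ([aux_norm_neq0]), and f has no rational root. *)

(** * A common multiple of binomial coefficients *)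

(** Legendre's formula with a flexible range, so that the valuations of n!, h!
and (n - h)! can be compared term by term. *)
Lemma logn_fact_trunc p m n : prime p -> n < p ^ m.+1 ->
  logn p n`! = \sum_(1 <= k < m.+1) n %/ p ^ k.
Proof.
move=> pp nlt; rewrite logn_fact //.
have zero a b c : n < p ^ a -> a <= b -> \sum_(b <= k < c) n %/ p ^ k = 0.
  move=> na ab; rewrite big_nat big1 // => k /andP[bk _]; rewrite divn_small //.
  by apply: leq_trans na _; rewrite leq_exp2l ?prime_gt1 //;
    apply: leq_trans bk.
have nn : n < p ^ n.+1.
  by apply: ltn_trans (ltnSn _) (ltn_expl _ (prime_gt1 pp)).
have [le|lt] := leqP n m.
  by rewrite (big_cat_nat (n := n.+1) (p := m.+1)) //= [X in _ + X](zero n.+1)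
    ?addn0.
rewrite (big_cat_nat (n := m.+1) (p := n.+1)) //=; last by rewrite ltnS ltnW.
by rewrite [X in _ + X](zero m.+1) ?addn0.
Qed.

(** Multiplying the sum of the k %/ p ^ j by p - 1 makes it telescope. *)
Lemma logn_fact_leq p k : prime p -> logn p k`! * p.-1 <= k.
Proof.
move=> pp; have p0 := prime_gt0 pp.
have kk : k < p ^ k.+1.
  by apply: ltn_trans (ltnSn _) (ltn_expl _ (prime_gt1 pp)).
rewrite (logn_fact_trunc pp kk).
suff H m : (\sum_(1 <= j < m.+1) k %/ p ^ j) * p.-1 + k %/ p ^ m <= k.
  exact: leq_trans (leq_addr _ _) (H k).
elim: m => [|m IH]; first by rewrite big_geq // mul0n expn0 divn1.
rewrite big_nat_recr //= mulnDl -addnA; apply: leq_trans IH.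
rewrite leq_add2l -mulnSr prednK // expnSr divnMA; exact: leq_trunc_div.
Qed.

Lemma logn_bin_fact p n h : prime p -> h <= n ->
  logn p n`! = logn p 'C(n, h) + (logn p h`! + logn p (n - h)`!).
Proof.
move=> pp hn; rewrite -(bin_fact hn) !lognM ?muln_gt0 ?fact_gt0 ?bin_gt0 //.
Qed.

(** In Legendre's formula for each of n!, h! and (n - h)!, every power of p up
to n contributes at most one unit to the valuation of the binomial
coefficient. *)
Lemma logn_bin_leq p n h : prime p -> h <= n -> 0 < n ->
  logn p 'C(n, h) <= trunc_log p n.
Proof.
move=> pp hn n0; set e := trunc_log p n.
have ne : n < p ^ e.+1 by apply: trunc_log_ltn; apply: prime_gt1.
have := logn_bin_fact pp hn.
rewrite (logn_fact_trunc pp ne) !(@logn_fact_trunc p e) //; try lia.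
rewrite -big_split /= => E.
have : \sum_(1 <= i < e.+1) n %/ p ^ i <=
       \sum_(1 <= i < e.+1) (1 + (h %/ p ^ i + (n - h) %/ p ^ i)).
  apply: leq_sum => i _; rewrite -{1}(subnKC hn) [1 + _]addnC.
  exact: leq_divDl.
by rewrite E [X in _ <= X]big_split /= sum_nat_const_nat muln1 subn1 leq_add2r.
Qed.

(** The p-adic valuation of the least common multiple of 1, ..., n is
[trunc_log p n]. When a power p ^ e <= n exceeds uphalf n, it contributes a
unit to the central binomial coefficient, while p ^ (e - 1) is at most half of
n. This is the induction step of Chebyshev's upper bound. *)
Lemma trunc_log_leq_logn_bin p n : prime p -> 1 < n ->
  trunc_log p n <= logn p 'C(n, n./2) + trunc_log p (uphalf n).
Proof.
move=> pp n1; set e := trunc_log p n; have p1 := prime_gt1 pp.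
have up : uphalf n = n - n./2
  by rewrite uphalf_half -{2}(odd_double_half n); lia.
have [le|lt] := leqP (p ^ e) (uphalf n).
  by apply: leq_trans (leq_addl _ _); apply: trunc_log_max.
have e0 : 0 < e.
  rewrite lt0n; apply: contraTneq lt => ->; rewrite -leqNgt expn0.
  by rewrite up; have := odd_double_half n; lia.
have ne : n < p ^ e.+1 by apply: trunc_log_ltn.
have pe : p ^ e <= n by apply: trunc_logP => //; lia.
have h1 : e.-1 <= trunc_log p (uphalf n).
  apply: trunc_log_max => //; rewrite up.
  have : p ^ e.-1 * 2 <= n.
    by apply: leq_trans pe; rewrite -{2}(prednK e0) expnSr leq_mul2l p1 orbT.
  by have := odd_double_half n; rewrite -muln2; lia.
have hn : n./2 <= n by have := odd_double_half n; lia.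
suff : 0 < logn p 'C(n, n./2) by lia.
have := logn_bin_fact pp hn.
rewrite (logn_fact_trunc pp ne) !(@logn_fact_trunc p e) //; try lia.
rewrite -big_split /= => E.
suff : \sum_(1 <= i < e.+1) (n./2 %/ p ^ i + (n - n./2) %/ p ^ i) <
       \sum_(1 <= i < e.+1) n %/ p ^ i by rewrite E; lia.
rewrite big_nat_recr //= [X in _ < X]big_nat_recr //= -addnS.
apply: leq_add.
  apply: leq_sum => i _; rewrite -[X in _ <= X %/ _](subnKC hn).
  by rewrite divnD ?expn_gt0 ?prime_gt0 // leq_addr.
have lt1 : n - n./2 < p ^ e by rewrite -up.
have lt2 : n./2 < p ^ e by have := odd_double_half n; lia.
by rewrite (divn_small lt1) (divn_small lt2) divn_gt0 // expn_gt0 prime_gt0.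
Qed.

Lemma bin_leq_exp2 n k : k <= n -> 'C(n, k) <= 2 ^ n.
Proof.
move=> kn; rewrite -[2]/(1 + 1) expnDn (bigD1 (inord k)) //= inordK //.
by rewrite !exp1n !muln1 leq_addr.
Qed.

(** The products 'C(n, n./2) * 'C(uphalf n, _) * ... of central coefficients
obtained by halving contain the least common multiple of 1, ..., n, hence
every 'C(n, h); each step at most multiplies by 4 ^ n./2. *)
Lemma bin_common_multiple n : exists2 L, 0 < L <= 4 ^ n &
  forall h, h <= n -> 'C(n, h) %| L.
Proof.
suff [L Lb HL] : exists2 L, 0 < L <= 4 ^ n &
    forall p, prime p -> trunc_log p n <= logn p L.
  exists L => // h hn; have [n0|n0] := posnP n.
    by move: hn; rewrite n0 leqn0 => /eqP ->; rewrite bin0 dvd1n.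
  apply/dvdn_partP; first by rewrite bin_gt0.
  move=> p; rewrite mem_primes => /andP[pp _]; rewrite p_part pfactor_dvdn //;
    last by case/andP: Lb.
  exact: leq_trans (logn_bin_leq pp hn n0) (HL p pp).
elim/ltn_ind: n => n IH; have [n1|n1] := leqP n 1.
  exists 1; first by rewrite expn_gt0.
  by move=> p pp; rewrite logn1 leqn0 trunc_log_eq0; have := prime_gt1 pp; lia.
have un : uphalf n < n by rewrite uphalf_half; have := odd_double_half n; lia.
have [L /andP[L0 L4] HL] := IH _ un.
have hn : n./2 <= n by have := odd_double_half n; lia.
exists ('C(n, n./2) * L); last first.
  move=> p pp; rewrite lognM ?bin_gt0 //.
  by apply: leq_trans (trunc_log_leq_logn_bin pp n1) _; rewrite leq_add2l HL.
rewrite muln_gt0 bin_gt0 hn L0 /=.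
apply: leq_trans (leq_mul (_ : _ <= 4 ^ n./2) L4) _; last first.
  by rewrite -expnD leq_exp2l // uphalf_half; have := odd_double_half n; lia.
have := odd_double_half n; move: (n./2) => m; case: (odd n) => /= <-;
  last first.
  by rewrite -(expnM 2 2) mul2n bin_leq_exp2 // -addnn leq_addr.
rewrite add1n -(@leq_pmul2l 2) // -(expnM 2 2) -expnS [2 * m]mul2n.
have := expnDn 1 1 m.*2.+1; rewrite -[1 + 1]/2 => ->.
rewrite -(big_mkord xpredT (fun i =>
  'C(m.*2.+1, i) * (1 ^ (m.*2.+1 - i) * 1 ^ i))).
rewrite (big_cat_nat (n := m)) //=; last by rewrite -addnn; lia.
rewrite [X in _ + X]big_ltn; last by rewrite -addnn; lia.
rewrite [X in _ + (_ + X)]big_ltn; last by rewrite -addnn; lia.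
rewrite !exp1n !muln1.
(* The two middle coefficients are equal and add up to at most 2 ^ (2 m + 1).
   *)
have -> : 'C(m.*2.+1, m.+1) = 'C(m.*2.+1, m).
  by rewrite -bin_sub; [congr binomial; rewrite -addnn; lia | rewrite -addnn;
    lia].
by lia.
Qed.

(** * Divisibility of a product of consecutive integers *)

Lemma prod_ffactz (x s : nat) :
  (\prod_(t < s) (x%:Z - (t : nat)%:Z) = (x ^_ s)%:Z)%R.
Proof.
elim: s => [|s IH]; first by rewrite big_ord0 ffactn0.
rewrite big_ord_recr /= IH ffactnSr PoszM.
have [le|lt] := leqP s x; first by rewrite subzn.
by rewrite ffact_small // !mul0r.
Qed.

Lemma fact_dvd_ffact x s : s`! %| x ^_ s.
Proof. by rewrite -bin_ffact dvdn_mull. Qed.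

(** Let g be the falling factorial of degree s. Lagrange interpolation at the
s + 1 nodes expresses its leading coefficient as 1 = \sum_i g(z_i) / \prod_(k
!= i) (z_i - z_k). Multiplied by Y, each term becomes an integer times a value
of g, and the values of g at integers are multiples of s!. *)
Lemma fact_dvd_common_multiple (I : finType) (z : I -> nat) (s Y : nat) :
    #|I| = s.+1 -> injective z ->
    (forall i, \prod_(k | k != i) `|z i - z k|%N %| Y) ->
  s`! %| Y.
Proof.
move=> cI zi dvdY.
pose w i : int := (\prod_(k | k != i) ((z i)%:Z - (z k)%:Z))%R.
have /fin_all_exists [c cP] i : exists c : int, (Y%:Z = c * w i)%R.
  apply/dvdzP; rewrite dvdzE /w.
  rewrite (big_morph absz abszM (erefl : absz 1 = 1)) /=.
  by rewrite (eq_bigr (fun k => `|z i - z k|%N)) ?dvdY // => k _; lia.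
pose g : {poly int} := (\prod_(t < s) ('X - ((t : nat)%:Z)%:P))%R.
pose l i : {poly int} := (\prod_(k | k != i) ('X - ((z k)%:Z)%:P))%R.
have sg : size g = s.+1
  by rewrite /g -big_enum /= size_prod_XsubC size_enum_ord.
have sl i : size (l i) = s.+1.
  rewrite /l -big_filter; case: big_enumP => e _ _ [_ se].
  rewrite size_prod_XsubC se -[RHS]cI (cardD1 i I); congr S.
  by apply: eq_card => k; rewrite !inE andbT.
have gz i : (g.[(z i)%:Z] = (z i ^_ s)%:Z)%R.
  rewrite -prod_ffactz /g horner_prod; apply: eq_bigr => t _.
  by rewrite hornerXsubC.
have lz i k : ((l i).[(z k)%:Z] = if k == i then w i else 0)%R.
  rewrite /l horner_prod; have [->|ki] := eqVneq k i.
    by apply: eq_bigr => t _; rewrite hornerXsubC.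
  by rewrite (bigD1 k) //= hornerXsubC subrr mul0r.
(* D is Y times the interpolation error: degree at most s, s + 1 roots. *)
pose D : {poly int} := (Y%:Z *: g - \sum_i (c i * (z i ^_ s)%:Z) *: l i)%R.
have D0 : D = 0%R.
  apply: (@roots_geq_poly_eq0 _ _ [seq (z i)%:Z%R | i <- enum I]).
  - apply/allP => _ /mapP[k _ ->]; apply/rootP.
    rewrite /D hornerD hornerN hornerZ gz horner_sum (bigD1 k) //=.
    rewrite hornerZ lz eqxx big1 ?addr0; last first.
      by move=> i ik; rewrite hornerZ lz eq_sym (negbTE ik) mulr0.
    by rewrite (cP k); ring.
  - by rewrite map_inj_uniq ?enum_uniq // => i j [/zi].
  rewrite size_map -cardT cI /D; apply: leq_trans (size_polyD _ _) _.
  rewrite geq_max size_polyN (leq_trans (size_scale_leq _ _)) ?sg //=.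
  apply: leq_trans (size_sum _ _ _) _; apply/bigmax_leqP => i _.
  by rewrite (leq_trans (size_scale_leq _ _)) ?sl.
have lead1 (p : {poly int}) : (p \is monic -> size p = s.+1 -> p`_s = 1)%R.
  by move=> /monicP; rewrite lead_coefE => + sp; rewrite sp.
have : (D`_s = 0)%R by rewrite D0 coef0.
rewrite /D coefB coefZ coef_sum lead1 ?sg ?monic_prod_XsubC // mulr1.
move=> /eqP; rewrite subr_eq0 => /eqP E.
suff : (s`!%:Z %| Y%:Z)%Z by rewrite dvdzE.
rewrite E; apply: rpred_sum => i _.
by rewrite coefZ lead1 ?sl ?monic_prod_XsubC // mulr1 dvdz_mull // dvdzE /=
  fact_dvd_ffact.
Qed.

Lemma ffactnD n a b : n ^_ (a + b) = n ^_ a * (n - a) ^_ b.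
Proof.
elim: b => [|b IH]; first by rewrite addn0 ffactn0 muln1.
by rewrite addnS !ffactnSr IH mulnA subnDA.
Qed.

Lemma prod_two_sides m j (F A B : nat -> nat) : j <= m ->
    (forall i, i < j -> F i = A (j - i)) ->
    (forall i, j < i -> F i = B (i - j)) ->
  \prod_(0 <= i < m.+1 | i != j) F i =
  (\prod_(1 <= k < j.+1) A k) * \prod_(1 <= k < (m - j).+1) B k.
Proof.
move=> jm FA FB; rewrite (big_cat_nat (n := j)) //=; last by apply: leqW.
congr (_ * _).
  rewrite big_nat_rev /= add0n [RHS]big_add1 /=.
  rewrite big_nat_cond [RHS]big_nat_cond; apply: congr_big => //.
    by move=> i /=; lia.
  by move=> i /andP[/andP[_ ij] _]; rewrite FA; [congr A|]; lia.
rewrite big_ltn_cond ?ltnS //= eqxx /= [RHS]big_add1 /=.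
rewrite -[j.+1]add0n big_addn subSS.
rewrite big_nat_cond [RHS]big_nat_cond; apply: congr_big => //.
  by move=> i /=; lia.
by move=> i /andP[/andP[_ ij] _]; rewrite FB; [congr B|]; lia.
Qed.

(** [block n (k * b)] is the product of the k * b + t over |t| <= n, written
as a falling factorial to make factorial divisors visible. *)
Definition block n x := (x + n) ^_ n.*2.+1.

(** A run of n + 1 consecutive factors leaves two shorter runs of n - h and h
factors on either side. *)
Lemma dvdn_block n x h : n < x -> h <= n ->
  h`! * (n - h)`! * (x + h) ^_ n.+1 %| block n x.
Proof.
move=> nx hn; have E : n.*2.+1 = (n - h) + n.+1 + h by rewrite -addnn; lia.
rewrite /block E !ffactnD (_ : x + n - (n - h) = x + h); last by lia.
rewrite [X in _ %| X]mulnC mulnA -[X in X %| _]mulnA.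
by rewrite -[X in _ %| X]mulnA dvdn_mul ?dvdn_mul ?fact_dvd_ffact.
Qed.

Lemma fact_dvd_block n x : (n.*2.+1)`! %| block n x.
Proof. exact: fact_dvd_ffact. Qed.

(** The loss in replacing n! by h! (n - h)! is a binomial coefficient, which L
absorbs for all h at once. *)
Lemma fact_mul_ffact_dvd_block L n x h :
    n < x -> h <= n -> 'C(n, h) %| L ->
  n`! * (x + h) ^_ n.+1 %| L * block n x.
Proof.
move=> nx hn CL; rewrite -(bin_fact hn) -mulnA dvdn_mul //.
exact: dvdn_block.
Qed.

Definition blocks n m b := \prod_(1 <= k < m.+1) block n (k * b).

Lemma dvdn_prod_nat a c (F G : nat -> nat) :
  (forall i, a <= i < c -> F i %| G i) ->
  \prod_(a <= i < c) F i %| \prod_(a <= i < c) G i.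
Proof.
move=> FG; rewrite big_nat_cond [X in _ %| X]big_nat_cond.
elim/big_rec2: _ => // i x y; rewrite andbT => iac; exact/dvdn_mul/FG.
Qed.

Lemma dvdn_blocks L m n b (F : nat -> nat) :
    (forall k, 0 < k -> n`! * F k %| L * block n (k * b)) ->
  n`! ^ m * \prod_(1 <= k < m.+1) F k %| L ^ m * blocks n m b.
Proof.
move=> H; have e c : c ^ m = \prod_(1 <= k < m.+1) c
  by rewrite prod_nat_const_nat subn1.
rewrite !e /blocks -!big_split /=; apply: dvdn_prod_nat => k /andP[k0 _].
exact: H.
Qed.

(** Among |j - i| with i != j, i <= 2 m, no value occurs more than twice and
those above m occur at most once. The blocks left over number exactly m,
whatever the value of j. *)
Lemma dvdn_blocks_leftover m j n b : j <= m.*2 ->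
  (n.*2.+1)`! ^ m * (blocks n j b * blocks n (m.*2 - j) b) %|
  blocks n m b * blocks n m.*2 b.
Proof.
wlog jm : j / j <= m.
  move=> W j2; have [jm|mj] := leqP j m; first exact: W.
  rewrite [blocks n j b * _]mulnC; have := W (m.*2 - j).
  by rewrite subKn //; apply; rewrite ?leq_subr // -addnn; lia.
move=> _; rewrite /blocks (big_cat_nat (n := j.+1) (p := m.+1)) //=.
rewrite (big_cat_nat (n := (m.*2 - j).+1) (p := m.*2.+1)) //=; last
  by rewrite ltnS leq_subr.
rewrite [X in _ %| X]mulnACA [X in X %| _]mulnC; apply: dvdn_mul => //.
have e : (n.*2.+1)`! ^ m = \prod_(j.+1 <= k < m.+1) (n.*2.+1)`! *
     \prod_((m.*2 - j).+1 <= k < m.*2.+1) (n.*2.+1)`!.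
  by rewrite !prod_nat_const_nat -expnD; congr expn; rewrite -addnn; lia.
by rewrite e; apply: dvdn_mul; apply: dvdn_prod_nat => k _;
  apply: fact_dvd_block.
Qed.

(** The nodes i * b + k with i = j give factorials; those with i < j and with
i > j give one falling factorial for each value of |j - i|. *)
Lemma prod_node_dist m n b j h : n < b -> j <= m -> h <= n ->
  \prod_(k : 'I_m.+1 * 'I_n.+1 | (k.1 != j :> nat) || (k.2 != h :> nat))
     `|j * b + h - (k.1 * b + k.2)|%N =
  (h`! * (n - h)`!) *
  ((\prod_(1 <= k < j.+1) (k * b + h) ^_ n.+1) *
    \prod_(1 <= k < (m - j).+1) (k * b + (n - h)) ^_ n.+1).
Proof.
move=> nb jm hn.
rewrite -(pair_big_dep xpredT
  (fun (i : 'I_m.+1) (k : 'I_n.+1) => (i != j :> nat) || (k != h :> nat))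
  (fun (i : 'I_m.+1) (k : 'I_n.+1) => `|j * b + h - (i * b + k)|%N)) /=.
rewrite (bigD1 (Ordinal (n := m.+1) (m := j) jm)) //= eqxx /=; congr (_ * _).
  rewrite -(big_mkord (fun k => k != h) (fun k =>
    `|j * b + h - (j * b + k)|%N)).
  rewrite (@prod_two_sides n h _ id id) // -?fact_prod // => k ?; lia.
rewrite (eq_bigr (fun i : 'I_m.+1 =>
  \prod_(k < n.+1) `|j * b + h - (i * b + k)|%N)); last first.
  by move=> i; rewrite -val_eqE /= => ->; apply: eq_bigl.
rewrite -(big_mkord (fun i => i != j)
  (fun i => \prod_(k < n.+1) `|j * b + h - (i * b + k)|%N)).
apply: (@prod_two_sides _ _ _ (fun k => (k * b + h) ^_ n.+1)
   (fun k => (k * b + (n - h)) ^_ n.+1)) => // i ij; rewrite ffact_prod.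
  apply: eq_bigr => k _.
  have -> : j * b = i * b + (j - i) * b by rewrite -mulnDl subnKC // ltnW.
  have : b <= (j - i) * b by rewrite leq_pmull // subn_gt0.
  by have := ltn_ord k; lia.
rewrite (reindex_inj rev_ord_inj) /=; apply: eq_bigr => k _.
have -> : i * b = j * b + (i - j) * b by rewrite -mulnDl subnKC // ltnW.
have : b <= (i - j) * b by rewrite leq_pmull // subn_gt0.
by have := ltn_ord k; lia.
Qed.

(** Even after division by n! ^ (2 m) * (2 n + 1)! ^ m, the right-hand side is
a common multiple of the products of differences between the nodes j * b + h.
*)
Lemma fact_dvd_blocks m n b L :
    n < b -> (forall h, h <= n -> 'C(n, h) %| L) ->
  ((m.*2.+1 * n.+1).-1)`! * (n`! ^ m.*2 * (n.*2.+1)`! ^ m) %|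
  L ^ m.*2 * n`! * (blocks n m b * blocks n m.*2 b).
Proof.
move=> nb HL; set T := n`! ^ m.*2 * _; set Y := L ^ m.*2 * _ * _.
pose z (k : 'I_m.*2.+1 * 'I_n.+1) := k.1 * b + k.2.
have b0 : 0 < b by lia.
have zi : injective z.
  move=> [i h] [j k]; rewrite /z /= => E.
  have hb (l : 'I_n.+1) : l < b by have := ltn_ord l; lia.
  have ij : i = j :> nat.
    by have := congr1 (divn^~ b) E;
      rewrite !divnMDl // !divn_small ?hb // !addn0.
  by congr pair; apply: val_inj => //=; move: E; rewrite ij => /addnI.
have dvdY i : \prod_(k | k != i) `|z i - z k|%N * T %| Y.
  case: i => j h; have jm : j <= m.*2 by rewrite -ltnS.
  have hn : h <= n by rewrite -ltnS.
  have -> : \prod_(k | k != (j, h)) `|z (j, h) - z k|%N =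
      \prod_(k : 'I_m.*2.+1 * 'I_n.+1 | (k.1 != j :> nat) || (k.2 != h :> nat))
     `|j * b + h - (k.1 * b + k.2)|%N.
    apply: eq_bigl => -[k l] /=.
    by rewrite -pair_eqE /= negb_and !val_eqE.
  rewrite prod_node_dist //.
  have kb k : 0 < k -> n < k * b.
    by move=> k0; apply: leq_trans nb _; rewrite leq_pmull.
  have D1 := @dvdn_blocks L j n b (fun k => (k * b + h) ^_ n.+1)
    (fun k k0 => fact_mul_ffact_dvd_block (kb k k0) hn (HL _ hn)).
  have hn' : n - h <= n by rewrite leq_subr.
  have D2 := @dvdn_blocks L (m.*2 - j) n b (fun k => (k * b + (n - h)) ^_ n.+1)
    (fun k k0 => fact_mul_ffact_dvd_block (kb k k0) hn' (HL _ hn')).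
  have D3 := dvdn_blocks_leftover n b jm.
  have D4 : h`! * (n - h)`! %| n`! by rewrite -(bin_fact hn) dvdn_mull.
  have e c : c ^ m.*2 = c ^ j * c ^ (m.*2 - j) by rewrite -expnD subnKC.
  rewrite /T /Y !e; move: D1 D2 D3 D4.
  move: (\prod_(1 <= k < j.+1) (k * b + h) ^_ n.+1) => A.
  move: (\prod_(1 <= k < (m.*2 - j).+1) (k * b + (n - h)) ^_ n.+1) => B.
  move: (n`! ^ j) (n`! ^ (m.*2 - j)) (L ^ j) (L ^ (m.*2 - j)) => a1 a2 l1 l2.
  move: (blocks n j b) (blocks n (m.*2 - j) b) => b1 b2.
  move: (blocks n m b * blocks n m.*2 b) => b3 D1 D2 D3 D4.
  have D12 := dvdn_mul D4 (dvdn_mul D1 D2).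
  apply: (@dvdn_trans (n`! * (l1 * b1 * (l2 * b2)) * (n.*2.+1)`! ^ m)).
    rewrite [X in X %| _](_ : _ = h`! * (n - h)`! * (a1 * A * (a2 * B))
      * (n.*2.+1)`! ^ m).
      by rewrite dvdn_mul.
    by ring.
  rewrite [X in X %| _](_ : _ = l1 * l2 * n`! * ((n.*2.+1)`! ^ m * (b1 * b2))).
    by rewrite dvdn_mul.
  by ring.
have T0 : 0 < T by rewrite muln_gt0 !expn_gt0 !fact_gt0.
have TY : T %| Y by apply: dvdn_trans (dvdY (ord0, ord0)); rewrite dvdn_mull.
rewrite -dvdn_divRL //; apply: (fact_dvd_common_multiple _ zi).
  by rewrite card_prod !card_ord prednK // muln_gt0.
by move=> i; rewrite dvdn_divRL // dvdY.
Qed.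

Local Open Scope ring_scope.

(** * Norms along the roots of a polynomial, and their prime powers *)

(** The homogeneous form of degree n in (k, t) whose value is k ^ n p(t / k):
it replaces the resultant of p with the linear form k X - t, and makes sense
over any ring. *)
Definition homogenization (A : comNzRingType) n (p : {poly A}) (k t : A) : A :=
  \sum_(i < n.+1) p`_i * t ^+ i * k ^+ (n - i).

Lemma homogenization_XsubC (A : comNzRingType) n (q : {poly A}) (z k t : A) :
  (size q <= n.+1)%N ->
  homogenization n.+1 (('X - z%:P) * q) k t = (t - k * z)
    * homogenization n q k t.
Proof.
move=> sq; rewrite /homogenization [RHS]mulrBl mulrBl.
rewrite (eq_bigr (fun i : 'I_n.+2 =>
   ('X * q)`_i * t ^+ i * k ^+ (n.+1 - i) -
   z * q`_i * t ^+ i * k ^+ (n.+1 - i))); last first.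
  by move=> i _; rewrite coefB coefCM !mulrBl.
rewrite sumrB; congr (_ - _).
  rewrite big_ord_recl coefXM /= !mul0r add0r mulr_sumr; apply: eq_bigr => i _.
  by rewrite coefXM /= /bump /= add1n subSS exprS; ring.
rewrite big_ord_recr /= nth_default // mulr0 !mul0r addr0 mulr_sumr.
by apply: eq_bigr => i _; rewrite subSn -1?ltnS // exprS; ring.
Qed.

Lemma homogenization_prod_XsubC (A : comNzRingType) (c : A) (zs : seq A)
  (k t : A) :
  homogenization (size zs) (c *: \prod_(z <- zs) ('X - z%:P)) k t =
  c * \prod_(z <- zs) (t - k * z).
Proof.
have homZ n p : homogenization n (c *: p) k t = c * homogenization n p k t.
  by rewrite /homogenization mulr_sumr; apply: eq_bigr => i _;
    rewrite coefZ -!mulrA.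
rewrite homZ; congr (_ * _); elim: zs => [|z zs IH].
  by rewrite !big_nil /homogenization big_ord1 coefC /= !expr0 !mulr1.
by rewrite /= !big_cons homogenization_XsubC ?IH // size_prod_XsubC.
Qed.

Lemma homogenization_map (A B : comNzRingType) (f : {rmorphism A -> B})
  n p k t :
  f (homogenization n p k t) = homogenization n (map_poly f p) (f k) (f t).
Proof.
rewrite rmorph_sum; apply: eq_bigr => i _.
by rewrite !rmorphM !rmorphXn coef_map.
Qed.

Lemma homogenization_horner (F : fieldType) n (p : {poly F}) k t :
  (size p <= n.+1)%N -> k != 0 -> homogenization n p k t = k ^+ n * p.[t / k].
Proof.
move=> sp k0; rewrite (horner_coef_wide _ sp) mulr_sumr; apply: eq_bigr => i _.
have i_n : (i <= n)%N by rewrite -ltnS.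
have -> : k ^+ n = k ^+ (n - i) * k ^+ i by rewrite -exprD subnK.
by rewrite expr_div_n; field; rewrite expf_neq0.
Qed.

Definition ring_block (A : comNzRingType) n (x : A) : A :=
  \prod_(i < n.*2.+1) (x + n%:R - i%:R).

(** The ring version of the multiple of factorials in [fact_dvd_blocks], at an
arbitrary argument z. *)
Definition aux_value (A : comNzRingType) L m n (z : A) : A :=
  L%:R ^+ m.*2 * (n`!)%:R *
  ((\prod_(1 <= k < m.+1) ring_block n (k%:R * z)) *
   \prod_(1 <= k < m.*2.+1) ring_block n (k%:R * z)).

(** Up to sign and a power of the leading coefficient, the norm of [aux_value]
over the roots of p, computed from the coefficients of p only. It is thus
compatible with reduction modulo prime powers as well as with the embedding
into the complex numbers. *)
Definition aux_norm (A : comNzRingType) L m n d (p : {poly A}) : A :=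
  let H k := \prod_(i < n.*2.+1) homogenization d p k%:R (i%:R - n%:R) in
  (L%:R ^+ m.*2 * (n`!)%:R) ^+ d *
  ((\prod_(1 <= k < m.+1) H k) * \prod_(1 <= k < m.*2.+1) H k).

Lemma aux_norm_map (A B : comNzRingType) (f : {rmorphism A -> B}) L m n d p :
  f (aux_norm L m n d p) = aux_norm L m n d (map_poly f p).
Proof.
rewrite /aux_norm !(rmorphM, rmorphXn, rmorph_nat, rmorph_prod).
congr (_ * (_ * _)); apply: eq_bigr => k _; rewrite rmorph_prod;
  by apply: eq_bigr => i _; rewrite homogenization_map rmorphB !rmorph_nat.
Qed.

(** Each linear factor of [aux_value] contributes one homogenization of p,
hence one power of c. *)
Lemma aux_norm_prod_XsubC (A : comNzRingType) L m n (c : A) (zs : seq A) :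
  aux_norm L m n (size zs) (c *: \prod_(z <- zs) ('X - z%:P)) =
  ((-1) ^+ size zs * c) ^+ (n.*2.+1 * (m + m.*2)) *
  \prod_(z <- zs) aux_value L m n z.
Proof.
have HE k : \prod_(i < n.*2.+1)
    homogenization (size zs) (c *: \prod_(z <- zs) ('X - z%:P))
      k%:R (i%:R - n%:R) =
    ((-1) ^+ size zs * c) ^+ n.*2.+1 * \prod_(z <- zs) ring_block n (k%:R * z).
  rewrite exchange_big /= -[X in _ ^+ X]card_ord -prodr_const -big_split /=.
  apply: eq_bigr => i _; rewrite homogenization_prod_XsubC mulrAC [_ *
    c]mulrC; congr (_ * _).
  elim: zs => [|z zs IH]; first by rewrite !big_nil expr0 mulr1.
  by rewrite !big_cons IH exprS; ring.
have HEs j : \prod_(1 <= k < j.+1) \prod_(i < n.*2.+1)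
    homogenization (size zs) (c *: \prod_(z <- zs) ('X - z%:P))
      k%:R (i%:R - n%:R) =
    ((-1) ^+ size zs * c) ^+ (n.*2.+1 * j) *
    \prod_(z <- zs) \prod_(1 <= k < j.+1) ring_block n (k%:R * z).
  rewrite (eq_bigr _ (fun k _ => HE k)) big_split /= exchange_big /=.
  by rewrite prodr_const_nat subn1 -exprM.
rewrite /aux_norm !HEs mulnDr exprD /aux_value !big_split /=.
have PC (x : A) : \prod_(z <- zs) x = x ^+ size zs.
  by elim: zs {HE HEs} => [|z zs IH]; rewrite ?big_nil // big_cons IH exprS.
rewrite !PC exprMn; ring.
Qed.

Lemma ring_block_nat (A : comNzRingType) n x : (n < x)%N ->
  ring_block n (x%:R : A) = (block n x)%:R.
Proof.
move=> nx; rewrite /ring_block /block ffact_prod natr_prod;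
  apply: eq_bigr => i _.
rewrite natrB ?natrD //; move: (ltn_ord i) => /=; move: (nat_of_ord i) => j.
by rewrite -addnn; lia.
Qed.

Lemma aux_value_nat (A : comNzRingType) L m n b : (n < b)%N ->
  aux_value L m n (b%:R : A) =
  (L ^ m.*2 * n`! * (blocks n m b * blocks n m.*2 b))%:R.
Proof.
move=> nb; rewrite /aux_value !natrM natrX; congr (_ * (_ * _));
  rewrite natr_prod big_nat_cond [RHS]big_nat_cond; apply: eq_bigr => k;
  rewrite andbT => /andP[k0 _]; rewrite -natrM ring_block_nat //;
  by apply: leq_trans nb _; rewrite leq_pmull.
Qed.

(** Taylor expansion with the remainder kept integral. *)
Lemma horner_Taylor2 (p : {poly int}) (x h : int) :
  exists r, p.[x + h] = p.[x] + p^`().[x] * h + r * h ^+ 2.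
Proof.
elim/poly_ind: p => [|p c [r IH]].
  by exists 0; rewrite deriv0 !horner0; ring.
exists (p^`().[x] + r * x + r * h).
by rewrite derivD derivM derivX derivC !(hornerD, hornerM, hornerX, hornerC)
  IH; ring.
Qed.


Lemma eqz_mod_horner (f : {poly int}) (d x y : int) :
  (x = y %[mod d])%Z -> (f.[x] = f.[y] %[mod d])%Z.
Proof.
move=> /eqP; rewrite eqz_mod_dvd => /dvdzP[q E]; apply/eqP; rewrite eqz_mod_dvd.
have [r] := horner_Taylor2 f y (q * d); rewrite -E addrC subrK => ->.
apply/dvdzP; exists (f^`().[y] * q + r * q ^+ 2 * d); rewrite E; ring.
Qed.

Lemma eqz_mod_dvdz (d x y : int)
  : (x = y %[mod d])%Z -> (d %| x)%Z = (d %| y)%Z.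
Proof. by move=> E; apply/dvdz_mod0P/dvdz_mod0P; rewrite E. Qed.

(** Newton's iteration, with an inverse of the derivative modulo p given by
Bezout. *)
Lemma Hensel (f : {poly int}) (p : nat) (a : int) : prime p ->
    (p %| f.[a])%Z -> ~~ (p %| f^`().[a])%Z ->
  forall e, exists2 b : int, (b = a %[mod p])%Z & ((p ^ e.+1)%N %| f.[b])%Z.
Proof.
move=> pp fa f'a; elim=> [|e [b ba]]; first by exists a.
move=> /dvdzP[u fb].
have f'b : coprimez p f^`().[b].
  rewrite coprimezE /= prime_coprime //; apply: contra f'a => f'b.
  by rewrite -(eqz_mod_dvdz (eqz_mod_horner f^`() ba)) dvdzE.
have [al [be]] := Bezoutz p f^`().[b]; rewrite (eqP f'b) => AB.
pose P : int := (p ^ e.+1)%N; pose s := - u * be.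
have PE : P = p%:Z * (p ^ e)%N by rewrite /P expnS PoszM.
exists (b + P * s).
  by rewrite -ba PE; apply/eqP;
    rewrite eqz_mod_dvd addrAC subrr add0r -!mulrA dvdz_mulr.
have [r ->] := horner_Taylor2 f b (P * s); rewrite fb -/P.
apply/dvdzP; exists (u * al + r * s ^+ 2 * (p ^ e)%N).
rewrite (expnS p e.+1) PoszM -/P.
have -> : u * P + f^`().[b] * (P * s) = P * u * (1 - be * f^`().[b])
  by rewrite /s; ring.
have -> : 1 - be * f^`().[b] = al * p by rewrite -AB; ring.
by rewrite !PE; ring.
Qed.

Lemma intr_Zp_eq0 q (k : int) : (1 < q)%N ->
  (k%:~R == 0 :> 'Z_q) = (q %| k)%Z.
Proof.
move=> q1; have nn (j : nat) : (j%:R == 0 :> 'Z_q) = (q %| j)%N.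
  by rewrite -val_eqE /= val_Zp_nat.
case: k => k; first exact: nn.
by rewrite NegzE rmorphN oppr_eq0; exact: (nn k.+1).
Qed.

(** Simple roots modulo p lift by [Hensel] and their differences stay
invertible modulo p ^ e.+1, so they are all the roots. They can be chosen
larger than n, as [fact_dvd_blocks] requires. *)
Lemma Zp_factorization (f : {poly int}) (p e n : nat) :
    prime p -> ~~ (p %| lead_coef f)%Z ->
    splits (map_poly intr f : {poly 'F_p}) ->
    separable_poly (map_poly intr f : {poly 'F_p}) ->
  exists2 bs : seq nat, (size bs = (size f).-1 /\ all (leq n.+1) bs) &
   map_poly intr f = (lead_coef f)%:~R *:
     \prod_(b <- bs) ('X - (b%:R)%:P) :> {poly 'Z_(p ^ e.+1)}.
Proof.
move=> pp pf [rs]; set g := map_poly intr f => grs sg.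
have lg : ((lead_coef f)%:~R : 'F_p) != 0
  by rewrite -(dvdz_pcharf (pchar_Fp pp)).
have szg : size g = size f by rewrite size_map_poly_id0.
have urs : uniq rs.
  by rewrite -separable_prod_XsubC -(eqp_separable grs).
have szrs : (size rs).+1 = size f
  by rewrite -szg (eqp_size grs) size_prod_XsubC.
have intr_nat (x : 'F_p) : ((x : nat)%:Z)%:~R = x :> 'F_p by exact: natr_Zp.
have root0 (h : {poly int}) (x : int) :
    (p %| h.[x])%Z = root (map_poly intr h : {poly 'F_p}) x%:~R.
  by rewrite (dvdz_pcharf (pchar_Fp pp)) /root horner_map.
have q1 : (1 < p ^ e.+1)%N by rewrite -[1%N](expn0 p) ltn_exp2l ?prime_gt1.
have lift (x : 'F_p) : x \in rs ->
   exists b : nat, [/\ (n < b)%N, b%:R = x & ((p ^ e.+1)%N %| f.[b%:Z])%Z].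
  move=> xrs; have fx : (p %| f.[(x : nat)%:Z])%Z.
    by rewrite root0 intr_nat -/g (eqp_root grs) root_prod_XsubC.
  have f'x : ~~ (p %| f^`().[(x : nat)%:Z])%Z.
    rewrite root0 intr_nat -deriv_map; move: sg; rewrite unlock => sg.
    by apply: (coprimep_root sg); move: fx; rewrite root0 intr_nat.
  have [b bx fb] := Hensel pp fx f'x e.
  pose q : int := (p ^ e.+1)%N.
  have q0 : 0 < q by rewrite /q ltz_nat (ltn_trans _ q1).
  (* A representative of b modulo q that exceeds n. *)
  pose b' := (b %% q)%Z + q * n.+1%:Z.
  have b'0 : n.+1%:Z <= b'.
    rewrite /b' -[X in X <= _]add0r lerD ?modz_ge0 ?gt_eqF //.
    by rewrite ler_peMl // -gtz0_ge1.
  have b'E : `|b'|%N = b' :> int by rewrite gez0_abs // (le_trans _ b'0).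
  have b'b : (b' = b %[mod q])%Z by rewrite /b' addrC mulrC modzMDl modz_mod.
  exists `|b'|%N; split.
  - by rewrite -ltz_nat b'E -[n%:Z]addr0; move: b'0; lia.
  - rewrite pmulrn b'E -[RHS]intr_nat; apply/eqP.
    rewrite -subr_eq0 -rmorphB -(dvdz_pcharf (pchar_Fp pp)) -eqz_mod_dvd -bx.
    rewrite eqz_mod_dvd (@dvdz_trans q) // -?eqz_mod_dvd ?b'b //.
    by rewrite dvdzE /= /q expnS dvdn_mulr.
  - by rewrite b'E (eqz_mod_dvdz (eqz_mod_horner f b'b)).
have [bs [sbs nbs mbs fbs]] : exists bs : seq nat,
    [/\ size bs = size rs, all (leq n.+1) bs, [seq b%:R : 'F_p | b <- bs] = rs
      & all (fun b : nat => (p ^ e.+1)%N %| f.[b%:Z])%Z bs].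
  elim: (rs) lift => [|x s IH] H; first by exists [::].
  have [b [nb bx fb]] := H x (mem_head _ _).
  have [|bs [h1 h2 h3 h4]] := IH; first
    by move=> y ys; apply: H; rewrite inE ys orbT.
  by exists (b :: bs); rewrite /= h1 h2 h3 h4 bx nb fb.
exists bs; first by rewrite sbs -szrs.
have qpos := intr_Zp_eq0 _ q1.
have lq : ((lead_coef f)%:~R : 'Z_(p ^ e.+1)) != 0.
  by rewrite qpos; apply: contra pf; apply: dvdz_trans;
    rewrite dvdzE /= expnS dvdn_mulr.
have -> : (lead_coef f)%:~R = lead_coef (map_poly intr f) :> 'Z_(p ^ e.+1).
  by rewrite lead_coef_map_eq.
rewrite -(big_map (fun b : nat => b%:R) xpredT (fun z => 'X - z%:P)).
apply: all_roots_prod_XsubC.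
- by rewrite size_map_poly_id0 // size_map sbs szrs.
- apply/allP => _ /mapP[b bbs ->]; rewrite /root.
  rewrite -[b%:R]/(b%:Z%:~R) horner_map qpos; exact: (allP fbs).
move: urs; rewrite -mbs; elim: bs {sbs nbs mbs fbs} =>
  //= b bs IH /andP[bbs /IH ->].
rewrite andbT; apply/allP => _ /mapP[c cbs ->];
  rewrite /diff_roots mulrC eqxx /=.
have bc : b%:R != c%:R :> 'F_p.
  by apply: contraNneq bbs => ->; apply/mapP; exists c.
wlog le : b c {bbs cbs} bc / (b <= c)%N.
  move=> W; have [|/ltnW] := leqP b c; first exact: W.
  by move=> cb; rewrite -unitrN opprB; apply: W; rewrite // eq_sym.
rewrite -natrB // unitZpE // coprimeXl ?coprimeXl // prime_coprime //.
rewrite (dvdn_pcharf (pchar_Fp pp)) natrB // subr_eq0 eq_sym //.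
Qed.

(** Modulo a power of p the norm is a unit times the product of the auxiliary
values at integers, each of which is divisible by p ^ w. *)
Lemma pexp_dvd_aux_norm (f : {poly int}) (p w L m n : nat) :
    prime p -> ~~ (p %| lead_coef f)%Z ->
    splits (map_poly intr f : {poly 'F_p}) ->
    separable_poly (map_poly intr f : {poly 'F_p}) ->
    (forall b, (n < b)%N ->
       p ^ w %| L ^ m.*2 * n`! * (blocks n m b * blocks n m.*2 b))%N ->
  ((p ^ (w * (size f).-1))%N %| aux_norm L m n (size f).-1 f)%Z.
Proof.
move=> pp pf sf sepf H; case E: (w * (size f).-1)%N => [|e]; first
  by rewrite expn0 dvd1z.
have [bs [sbs nbs] fbs] := @Zp_factorization f p e n pp pf sf sepf.
have q1 : (1 < p ^ e.+1)%N by rewrite -[1%N](expn0 p) ltn_exp2l ?prime_gt1.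
rewrite -(intr_Zp_eq0 _ q1) aux_norm_map fbs -sbs -(size_map (fun b : nat =>
  b%:R : 'Z_(p ^ e.+1)) bs).
rewrite -(big_map (fun b : nat => b%:R) xpredT (fun z =>
  'X - z%:P)) aux_norm_prod_XsubC.
rewrite big_map (_ : \prod_(b <- bs) _ = 0) ?mulr0 //.
pose F b := (L ^ m.*2 * n`! * (blocks n m b * blocks n m.*2 b))%N.
have -> : \prod_(b <- bs) aux_value L m n (b%:R : 'Z_(p ^ e.+1)) =
    (\prod_(b <- bs) F b)%N%:R.
  rewrite natr_prod big_seq [RHS]big_seq; apply: eq_bigr => b bbs.
  by rewrite aux_value_nat // (allP nbs).
apply/eqP; rewrite -[_%:R]/((Posz _)%:~R) intr_Zp_eq0 // dvdzE /= -E -sbs.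
rewrite expnM.
elim: bs nbs {sbs fbs} => [|b bs IH]; first by rewrite big_nil.
by move=> /= /andP[nb /IH bD]; rewrite big_cons expnS dvdn_mul ?H.
Qed.

(** * Roots of the square-free part, and its resultant *)

Lemma dvdp_map_intr (C : numFieldType) (D P : {poly int}) :
  D %| P -> map_poly intr D %| (map_poly intr P : {poly C}).
Proof.
move=> /Pdiv.Idomain.dvdpP[[c q] /= c0 E].
rewrite -(@dvdpZr _ c%:~R) ?intr_eq0 // -map_polyZ E rmorphM /=.
exact: dvdp_mulIr.
Qed.

Lemma root_gcdp_intr (C : numClosedFieldType) (P Q : {poly int}) : P != 0 ->
  (1 < size (gcdp P Q))%N ->
  exists2 z : C, root (map_poly intr P) z & root (map_poly intr Q) z.
Proof.
move=> P0 sg; have inj := @intr_inj C.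
have /closed_rootP[z gz] : size (map_poly intr (gcdp P Q) : {poly C}) != 1%N.
  by rewrite size_map_inj_poly // gtn_eqF.
by exists z; move: gz; rewrite -!dvdp_XsubCl => /dvdp_trans; apply;
  apply: dvdp_map_intr; rewrite ?dvdp_gcdl ?dvdp_gcdr.
Qed.

Lemma sqr_XsubC_dvdp (F : idomainType) (P : {poly F}) z :
  root P z -> root P^`() z -> ('X - z%:P) ^+ 2 %| P.
Proof.
move=> /factor_theorem[q ->]; rewrite derivM derivXsubC mulr1 rootE hornerD.
rewrite hornerM hornerXsubC subrr mulr0 add0r => qz.
by rewrite expr2 dvdp_mul // dvdp_XsubCl.
Qed.

(** If z has multiplicity m in R, it has multiplicity m - 1 in R', hence in
the gcd G: from below by Bezout's identity over Z, from above because G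
divides R'. So it has multiplicity one in R / G. *)
Lemma squarefree_part_simple_roots (C : numClosedFieldType)
  (R R0 : {poly int}) z :
    R != 0 -> is_squarefree_part R0 R -> root (map_poly intr R : {poly C}) z ->
  root (map_poly intr R0) z /\ ~~ root (map_poly intr R0^`()) z.
Proof.
move=> Rn0 [G [GR GR' Gmax] RE] Rz; have inj := @intr_inj C.
set P : {poly C} := map_poly intr R.
have P0 : P != 0 by rewrite map_poly_eq0_id0 // intr_eq0 lead_coef_eq0.
have [m] := multiplicity_XsubC P z; rewrite P0 /= => -[q qz PE].
have m0 : (0 < m)%N.
  by case: m PE => // PE; move: Rz; rewrite -/P PE expr0 mulr1 (negbTE qz).
set X := 'X - z%:P in PE.
have P'E : P^`() = X ^+ m.-1 * (q^`() * X + q *+ m).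
  rewrite PE derivM deriv_exp derivXsubC mul1r; case: m m0 {PE} => // k _ /=.
  rewrite exprS mulrDr !mulrnAr [q * _]mulrC; congr (_ + _).
  by rewrite [X * _]mulrC mulrCA.
have NP' : ~~ (X ^+ m %| P^`()).
  rewrite P'E -[in X ^+ m](prednK m0)
    exprSr dvdp_mul2l ?expf_neq0 ?polyXsubC_eq0 //.
  rewrite dvdp_addr ?dvdp_mull // dvdp_XsubCl rootE hornerMn mulrn_eq0.
  by rewrite negb_or -lt0n m0.
have GX : X ^+ m.-1 %| map_poly intr G.
  (* G is a gcd over Z only; the primitive part of the gcd over Q divides it.
     *)
  pose h := zprimitive (gcdp R R^`()).
  have h0 : h != 0 by rewrite zprimitive_eq0 gcdp_eq0 negb_and Rn0.
  have hz D : h %| D -> zpoly_dvd h D.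
    move=> hD; apply/zpoly_dvdE => //; split => //.
    by rewrite zcontents_primitive gcdp_eq0 negb_and Rn0 /= dvd1z.
  have hg : h %= gcdp R R^`().
    rewrite [X in _ %= X]zpolyEprim eqp_sym; apply: eqp_scale.
    by rewrite zcontents_eq0 gcdp_eq0 negb_and Rn0.
  have [Q ->] : zpoly_dvd h G.
    by apply: Gmax; apply: hz; rewrite (eqp_dvdl _ hg) ?dvdp_gcdl ?dvdp_gcdr.
  rewrite rmorphM /= dvdp_mull //.
  have [u ug] := Pdiv.Idomain.Bezoutp R R^`().
  have uh : u.1 * R + u.2 * R^`() %| h
    by rewrite (eqp_dvdr _ hg) (eqp_dvdl _ ug).
  apply: dvdp_trans (dvdp_map_intr C uh).
  rewrite rmorphD !rmorphM /= dvdp_add // dvdp_mull //.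
    by rewrite -/P PE -{2}(prednK m0) exprSr mulrA dvdp_mulr ?dvdp_mull.
  by rewrite -deriv_map -/P P'E dvdp_mulr.
have GP' : map_poly intr G %| P^`().
  by case: GR' => Q E; rewrite /P deriv_map E rmorphM dvdp_mulIr.
have PRG : P = map_poly intr R0 * map_poly intr G by rewrite /P RE rmorphM.
have R0z : root (map_poly intr R0) z.
  apply: contraNT NP' => zR0; apply: dvdp_trans GP'.
  rewrite -(@Gauss_dvdpr _ _ (map_poly intr R0)) -?PRG ?PE ?dvdp_mull //.
  by rewrite coprimep_expl // coprimep_sym coprimep_XsubC.
split=> //; apply: contra qz; rewrite -deriv_map => R0'z.
have := dvdp_mul (sqr_XsubC_dvdp R0z R0'z) GX; rewrite -PRG PE -exprD.
rewrite (_ : 2 + m.-1 = 1 + m)%N; last by lia.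
by rewrite exprD expr1 dvdp_mul2r ?expf_neq0 ?polyXsubC_eq0 // dvdp_XsubCl.
Qed.

Lemma squarefree_part_resultant_neq0 (R R0 : {poly int}) :
  R != 0 -> is_squarefree_part R0 R -> resultant R0 R0^`() != 0.
Proof.
move=> Rn0 sR; have [G _ RE] := sR.
have R0n0 : R0 != 0 by apply: contraNneq Rn0 => R00; rewrite RE R00 mul0r.
rewrite resultant_eq0 -leqNgt leqNgt.
apply/negP => /(@root_gcdp_intr algC _ _ R0n0)[z R0z R0'z].
have Rz : root (map_poly intr R) z by rewrite RE rmorphM rootM R0z.
by case: (squarefree_part_simple_roots Rn0 sR Rz) => _ /negP.
Qed.

Lemma size_deriv_int (P : {poly int}) : size P^`() = (size P).-1.
Proof.
have [->|P0] := eqVneq P 0; first by rewrite deriv0 size_poly0.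
have := lt_size_deriv P0; move: P0; rewrite -lead_coef_eq0 lead_coefE.
case: (size P) => [//|[|k]] /= Pk; first by rewrite ltnS leqn0 => /eqP.
rewrite ltnS => sP'; apply/eqP; rewrite eqn_leq sP' ltnNge; apply/negP => H.
have : P^`()`_k = 0 by rewrite nth_default.
by rewrite coef_deriv => /eqP; rewrite mulrn_eq0 (negbTE Pk).
Qed.

(** All the entries in the last column of the Sylvester matrix are multiples
of the leading coefficient. *)
Lemma lead_coef_dvd_resultant (P : {poly int}) : (1 < size P)%N ->
  (lead_coef P %| resultant P P^`())%Z.
Proof.
move=> sP; have sP' := size_deriv_int P.
have j0 : (((size P^`()).-1 + (size P).-1).-1 < (size P^`()).-1 + (size
  P).-1)%N.
  by rewrite sP'; case: (size P) sP => [|[|k]] //= _; lia.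
rewrite /resultant (expand_det_col _ (Ordinal j0)); apply: rpred_sum => i _.
rewrite dvdz_mulr // Sylvester_mxE /=.
have lead k : ((size P).-1 <= k)%N -> (lead_coef P %| P`_k)%Z.
  rewrite leq_eqVlt => /orP[/eqP <-|]; first by rewrite lead_coefE dvdzz.
  by move=> lk; rewrite nth_default ?dvdz0 //; case: (size P) lk.
case: (fintype.split i) => k; apply: rpredMn; have kl := ltn_ord k.
  by apply: lead; move: kl; move: (nat_of_ord k) => l /=; rewrite sP';
    case: (size P) sP => [|[|s]] //= _; lia.
rewrite coef_deriv; apply: rpredMn; apply: lead; move: kl;
  move: (nat_of_ord k) => l /=;
  rewrite sP'. case: (size P) sP => [|[|s]] //= _; lia.
Qed.

(** The resultant is a combination of P and P'; the reduction modulo p of that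
identity is a Bezout identity. *)
Lemma separable_mod_prime (P f : {poly int}) (p : nat) :
    prime p -> ~~ (p %| resultant P P^`())%Z -> (2 < size P)%N ->
    zpoly_dvd f P ->
  separable_poly (map_poly intr f : {poly 'F_p}).
Proof.
move=> pp pD sP [q PE]; have sP' : (1 < size P^`())%N.
  by rewrite size_deriv_int; case: (size P) sP.
have [[u v] /= _ uvE] := resultant_in_ideal (ltnW sP) sP'.
have : separable_poly (map_poly intr P : {poly 'F_p}).
  rewrite unlock; apply/Bezout_coprimepP.
  exists (map_poly intr u, map_poly intr v) => /=.
  rewrite deriv_map -!rmorphM -rmorphD /= -uvE map_polyC polyC_eqp1.
  by rewrite -(dvdz_pcharf (pchar_Fp pp)).
by apply: dvdp_separable; rewrite PE rmorphM dvdp_mulIr.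
Qed.

(** * Splitting over the rationals *)

Definition linpoly (ba : int * int) : {poly int} := ba.1 *: 'X - (ba.2)%:P.

(** By Gauss's lemma rational roots can be divided out over Z, until none is
left. *)
Lemma linear_factors_or_no_root (R : {poly int}) : R != 0 ->
  (exists c s, R = c *: \prod_(ba <- s) linpoly ba) \/
  (exists f, [/\ zpoly_dvd f R, (2 < size f)%N
               & forall x : rat, ~~ root (map_poly intr f) x]).
Proof.
have [n] := ubnP (size R); elim: n R => // n IH R sR Rn0.
have [/negP H|[x Rx]] : ~~ `[< exists x : rat, root (map_poly intr R) x >] \/
    exists x : rat, root (map_poly intr R) x.
- by case: asboolP; [right|left].
- have nr (x : rat) : ~~ root (map_poly intr R) x.
    by apply/negP => Rx; apply: H; apply/asboolP; exists x.
  have sRR : size (map_poly intr R : {poly rat}) = size R.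
    by rewrite size_map_inj_poly //; apply: intr_inj.
  case E: (size R) => [|[|[|k]]].
  + by move/eqP: E; rewrite size_poly_eq0 (negbTE Rn0).
  + left; exists R`_0, [::]; rewrite big_nil alg_polyC; apply: size1_polyC.
    by rewrite E.
  + have [x Rx] := @poly2_root _ (map_poly intr R : {poly rat}) (etrans sRR E).
    by have := nr x; rewrite Rx.
  + right; exists R; split => //; first by exists 1; rewrite mul1r.
    by rewrite E.
pose D : {poly int} := linpoly (denq x, numq x).
have DR : D %| R.
  rewrite -dvdp_rat_int rmorphB /= linearZ /= map_polyX map_polyC /=.
  rewrite -[x]divq_num_den in Rx.
  have -> : (denq x)%:~R *: 'X - ((numq x)%:~R)%:P =
     (denq x)%:~R *: ('X - ((numq x)%:~R / (denq x)%:~R)%:P) :> {poly rat}.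
    by rewrite scalerBr -mul_polyC -[X in _ = _ - X]mul_polyC -polyCM mulrCA
      divff ?mulr1 ?intr_eq0.
  by rewrite dvdpZl ?intr_eq0 // dvdp_XsubCl.
have [q RE] := dvdpP_int DR; set E := zprimitive D in RE.
have sE : size E = 2%N.
  rewrite size_zprimitive /D /linpoly /= size_polyDl ?size_polyN.
    by rewrite size_scale ?size_polyX.
  by rewrite size_scale ?size_polyX // size_polyC; case: eqP.
have EE : E = linpoly (E`_1, - E`_0).
  rewrite /linpoly /= polyCN opprK; apply/polyP => i.
  rewrite coefD coefZ coefX coefC; case: i => [|[|i]] /=;
    rewrite ?mulr0 ?mulr1 ?add0r ?addr0 //.
  by rewrite nth_default // sE.
have q0 : q != 0 by apply: contraNneq Rn0 => q0; rewrite RE q0 mulr0.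
have E0 : E != 0 by rewrite -size_poly_eq0 sE.
case: (IH q _ q0) => [|[c [s qE]]|[f [[g qE] sf fr]]].
- by move: sR; rewrite RE size_mul // sE.
- left; exists c, ((E`_1, - E`_0) :: s).
  by rewrite big_cons -EE RE qE -scalerAr.
right; exists f; split => //; exists (E * g).
by rewrite RE qE mulrA.
Qed.

Lemma splits_mul (F : fieldType) (P Q : {poly F}) :
  splits P -> splits Q -> splits (P * Q).
Proof.
move=> [r /andP[P1 P2]] [s /andP[Q1 Q2]]; exists (r ++ s).
by rewrite big_cat /eqp !dvdp_mul.
Qed.

Lemma splits_linpoly (F : fieldType) (ba : int * int) :
  (lead_coef (linpoly ba))%:~R != 0 :> F ->
  splits (map_poly intr (linpoly ba) : {poly F}).
Proof.
case: ba => b a; rewrite /linpoly /= => lF.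
have [b0|b0] := eqVneq (b%:~R : F) 0; last first.
  exists [:: a%:~R / b%:~R];
    rewrite big_seq1 rmorphB /= linearZ /= map_polyX map_polyC /=.
  apply/eqpP; exists (1, b%:~R); rewrite /= ?oner_eq0 //.
  by rewrite scale1r scalerBr -[X in _ = _ - X]mul_polyC -polyCM mulrCA divff
    ?mulr1.
have b0' : b = 0.
  apply: contraTeq lF => bn0; rewrite negbK lead_coefDl.
    by rewrite lead_coefZ lead_coefX mulr1 b0.
  by rewrite size_polyN size_scale ?size_polyX // size_polyC; case: eqP.
exists [::]; rewrite big_nil b0' scale0r sub0r -polyCN map_polyC polyC_eqp1.
by move: lF; rewrite b0' scale0r sub0r -polyCN lead_coefC.
Qed.

Lemma splits_linear_factors (F : fieldType) (c : int) (s : seq (int * int)) :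
  ((lead_coef (c *: \prod_(ba <- s) linpoly ba))%:~R : F) != 0 ->
  splits (map_poly intr (c *: \prod_(ba <- s) linpoly ba) : {poly F}).
Proof.
rewrite lead_coefZ rmorphM mulf_eq0 negb_or linearZ /= => /andP[c0 ls].
suff [rs Hs] : splits (map_poly intr (\prod_(ba <- s) linpoly ba) : {poly F}).
  by exists rs; rewrite (eqp_ltrans (eqp_scale _ c0)).
elim: s ls => [|ba s IH]; first by exists [::]; rewrite !big_nil rmorph1 eqpxx.
rewrite !big_cons lead_coefM rmorphM mulf_eq0 negb_or => /andP[l1 l2].
by rewrite rmorphM; apply: splits_mul; [apply: splits_linpoly | apply: IH].
Qed.

Lemma no_root_not_splits (R f : {poly int}) : zpoly_dvd f R -> (2 < size f)%N ->
  (forall x : rat, ~~ root (map_poly intr f) x) ->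
  ~ splits (map_poly intr R : {poly rat}).
Proof.
move=> [q ->] sf nr [rs]; rewrite rmorphM => E.
have : map_poly intr f %| \prod_(z <- rs) ('X - z%:P).
  by rewrite -(eqp_dvdr _ E) dvdp_mulIr.
move=> /dvdp_prod_XsubC[m]; case: (mask m rs) => [|z zs] Ef.
  have := eqp_size Ef; rewrite size_map_inj_poly //; last exact: intr_inj.
  by rewrite big_nil size_poly1 => sf1; rewrite sf1 in sf.
by have := nr z; rewrite (eqp_root Ef) root_prod_XsubC mem_head.
Qed.

(** All the complex roots of R are roots of R0, hence rational. *)
Lemma splits_of_squarefree_part (R R0 : {poly int}) : R != 0 ->
  is_squarefree_part R0 R ->
  splits (map_poly intr R0 : {poly rat})
    -> splits (map_poly intr R : {poly rat}).
Proof.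
move=> Rn0 sR [rs Ers].
have mapQC (P : {poly int}) :
    map_poly intr P = map_poly ratr (map_poly intr P : {poly rat})
      :> {poly algC}.
  by rewrite -map_poly_comp; apply: eq_map_poly => i /=; rewrite ratr_int.
have [zs Ezs] := closed_field_poly_normal (map_poly intr R : {poly algC}).
have l0 : lead_coef (map_poly intr R : {poly algC}) != 0.
  by rewrite lead_coef_eq0 map_poly_eq0_id0 // intr_eq0 lead_coef_eq0.
have [ys zE] : exists ys : seq rat, zs = map ratr ys.
  have : {in zs, forall z, exists y : rat, z = ratr y}.
    move=> z zzs; have Rz : root (map_poly intr R) z.
      by rewrite Ezs rootZ // root_prod_XsubC.
    have [] := squarefree_part_simple_roots Rn0 sR Rz.
    rewrite mapQC (eqp_root (q := map_poly ratr (\prod_(z <- rs)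
      ('X - z%:P)))); last first.
      by rewrite eqp_map.
    rewrite rmorph_prod /= (eq_bigr (fun y : rat => 'X - (ratr y)%:P));
      last first.
      by move=> y _; rewrite rmorphB /= map_polyX map_polyC.
    rewrite -(big_map ratr xpredT (fun z => 'X - z%:P)) root_prod_XsubC.
    by case/mapP => y _ ->; exists y.
  elim: (zs) => [|z s IH] H; first by exists [::].
  have [|ys ->] := IH; first by move=> y ys; apply: H; rewrite inE ys orbT.
  by have [y ->] := H z (mem_head _ _); exists (y :: ys).
exists ys; rewrite -(eqp_map (ratr : {rmorphism rat -> algC})) -mapQC Ezs zE.
rewrite (eqp_ltrans (eqp_scale _ l0)) big_map rmorph_prod /=.
rewrite [X in _ %= X](eq_bigr (fun y : rat => 'X - (ratr y)%:P)) ?eqpxx //.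
by move=> y _; rewrite rmorphB /= map_polyX map_polyC.
Qed.

(** * Elementary bounds on products, exponentials and factorials *)

(** The left-hand side is 1 at 0, and its derivative is - 2 y (1 - y) (1 - 2
y)^2 exp (4 y). *)
Lemma expR4_quartic_le1 (K : realType) (y : K) : 0 <= y -> y <= 1 ->
  expR y ^+ 4 * ((1 - y) ^+ 2 * (1 - 2 * y + 2 * y ^+ 2)) <= 1.
Proof.
move=> y0 y1.
pose p : {poly K} := (1 - 'X) * (1 - 'X) * (1 - 2%:P * 'X + 2%:P * ('X * 'X)).
have pE x : p.[x] = (1 - x) ^+ 2 * (1 - 2 * x + 2 * x ^+ 2).
  rewrite /p !(hornerM, hornerX, hornerC, hornerD, hornerN); ring.
have p'E x : p^`().[x] = - 4 + 14 * x - 18 * x ^+ 2 + 8 * x ^+ 3.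
  rewrite /p !(derivM, derivD, derivN, derivX, derivC).
  rewrite !(hornerM, hornerX, hornerC, hornerD, hornerN); ring.
pose f := (expR : K -> K) ^+ 4 * horner p.
have f'E (x : K) : is_derive x (1 : K) f
   (- (expR x ^+ 4 * (2 * x * (1 - x) * (1 - 2 * x) ^+ 2))).
  apply: is_derive_eq; rewrite p'E pE.
  rewrite -![_ *: _]/(_ * _) fctE /= !exprS expr0.
  move: (expR x : K) => u; ring.
have : f y <= f 0.
  apply: (@ler0_derive1_nincr _ f 0 1) => //.
  - move=> x; rewrite in_itv /= => /andP[x0 x1].
    rewrite derive1E derive_val oppr_le0 mulr_ge0 ?exprn_ge0 ?expR_ge0 //.
    by rewrite mulr_ge0 ?sqr_ge0 // mulr_ge0 ?subr_ge0 ?(ltW x1)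
      // mulr_ge0 // ltW.
  - apply: derivable_within_continuous => x _; exact: ex_derive.
by rewrite /f !fctE !pE expR0 expr1n !mulr0 !subr0 expr0n /= mulr0 addr0
  expr1n !mulr1.
Qed.

(** exp (- 1 / 7) >= 6 / 7, and (7 / 6)^7 < 3. *)
Lemma expR1_le3 (K : realType) : expR 1 <= 3 :> K.
Proof.
have h : expR (7%:R^-1) <= 7 / 6 :> K.
  have := expR_ge1Dx (- (7%:R^-1 : K)); rewrite expRN => H.
  rewrite -[expR _]invrK -[7 / 6]invrK lef_pV2 ?posrE ?invr_gt0 ?expR_gt0 //;
    lra.
have -> : expR 1 = expR (7%:R^-1) ^+ 7 :> K by rewrite -expRM_natl mulfV.
apply: le_trans (lerXn2r 7 _ _ h) _; rewrite ?nnegrE ?expR_ge0 //; lra.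
Qed.

Lemma expR53_le (K : realType) : expR (5 / 3) <= 25 / 4 :> K.
Proof.
rewrite -(@ler_pXn2r _ 3) ?nnegrE ?expR_ge0 //.
have -> : expR (5 / 3) ^+ 3 = expR 1 ^+ 5 :> K.
  by rewrite -!expRM_natl; congr expR; lra.
apply: le_trans (lerXn2r 5 _ _ (expR1_le3 K)) _; rewrite ?nnegrE ?expR_ge0 //.
by rewrite !exprS expr0; lra.
Qed.

(** By induction on n the product is at most (1 + x / n)^(4 n). With y = x /
(m + 1 + x), the step from m = n.+1 to m + 1 reduces to [expR4_quartic_le1],
because (1 + x / m)^m <= (1 + x / (m + 1))^m exp y. *)
Lemma prod_1Dsqr_le (K : realType) (x : K) n : 0 <= x ->
  \prod_(1 <= t < n.+1) (1 + x ^+ 2 / t%:R ^+ 2) <= expR (4 * x).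
Proof.
move=> x0; case: n => [|n].
  rewrite big_geq //; apply: le_trans (expR_ge1Dx _); by rewrite lerDl mulr_ge0.
have pos j : 0 < 1 + x / j.+1%:R :> K.
  by rewrite ltr_pwDl // divr_ge0 // ler0n.
suff H : \prod_(1 <= t < n.+2) (1 + x ^+ 2 / t%:R ^+ 2) <=
    (1 + x / n.+1%:R) ^+ (4 * n.+1).
  apply: le_trans H _; rewrite mulnC exprM.
  rewrite expRM_natl lerXn2r ?nnegrE ?exprn_ge0 ?expR_ge0 ?(ltW (pos _)) //.
  have -> : x = n.+1%:R * (x / n.+1%:R) by rewrite mulrC divfK ?pnatr_eq0.
  rewrite expRM_natl mulrC mulKf ?pnatr_eq0 // lerXn2r ?nnegrE ?expR_ge0 ?(ltW
    (pos _)) //.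
  exact: expR_ge1Dx.
elim: n => [|n IH].
  rewrite big_nat1 expr1n !divr1 muln1 !exprS expr0 !mulr1.
  have := mulr_ge0 x0 x0; have := mulr_ge0 (mulr_ge0 x0 x0) x0.
  have := mulr_ge0 (mulr_ge0 x0 x0) (mulr_ge0 x0 x0).
  by nra.
rewrite big_nat_recr //=; set m : K := n.+1%:R in IH *.
have m0 : 0 < m by rewrite ltr0n.
have -> : n.+2%:R = m + 1 :> K by rewrite /m -natr1.
pose y := x / (m + 1 + x).
have y0 : 0 <= y by rewrite divr_ge0 // addr_ge0 // ltW // ltr_wpDl // ltW.
have y1 : y <= 1 by rewrite ler_pdivrMr; lra.
pose a := 1 + x / (m + 1).
have a0 : 0 < a by rewrite /a ltr_pwDl // divr_ge0 //; lra.
have h1 : (1 + x / m) ^+ n.+1 <= a ^+ n.+1 * expR y.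
  have -> : 1 + x / m = a * (1 + y / m).
    by rewrite /a /y; field; rewrite !gt_eqF //=; lra.
  rewrite exprMn ler_pM2l ?exprn_gt0 //.
  have -> : y = n.+1%:R * (y / m) by rewrite mulrC divfK ?gt_eqF.
  rewrite expRM_natl mulrC mulKf ?gt_eqF // lerXn2r ?nnegrE ?expR_ge0 //;
    last exact: expR_ge1Dx.
  by rewrite addr_ge0 // divr_ge0 // ltW.
have h2 : 1 + x ^+ 2 / (m + 1) ^+ 2 = a ^+ 2 * (1 - 2 * y + 2 * y ^+ 2).
  by rewrite /a /y; field; rewrite !gt_eqF //=; lra.
(* a = 1 / (1 - y): y is the value for which [expR4_quartic_le1] applies. *)
have h3 : a * (1 - y) = 1.
  by rewrite /a /y; field; rewrite !gt_eqF //=; lra.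
have q0 : 0 <= 1 - 2 * y + 2 * y ^+ 2 by nra.
have := expR4_quartic_le1 y0 y1 => h4.
apply: le_trans (ler_wpM2r _ IH) _; first
  by rewrite h2 mulr_ge0 ?exprn_ge0 // ltW.
rewrite mulnC exprM h2 mulnS exprD -/a.
apply: (@le_trans _ _ ((a ^+ n.+1 * expR y)
  ^+ 4 * (a ^+ 2 * (1 - 2 * y + 2 * y ^+ 2)))).
  rewrite ler_wpM2r //; first by rewrite mulr_ge0 ?exprn_ge0 // ltW.
  rewrite lerXn2r ?nnegrE ?exprn_ge0 ?mulr_ge0 ?exprn_ge0 ?expR_ge0 ?(ltW a0)
    //.
  by rewrite ltW // ltr_pwDl // divr_ge0 // ltW.
rewrite exprMn -exprM [(n.+1 * 4)%N]mulnC -mulrA mulrC ler_wpM2r ?exprn_ge0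
  ?(ltW a0) //.
have -> : expR y ^+ 4 * (a ^+ 2 * (1 - 2 * y + 2 * y ^+ 2)) =
   a ^+ 4 * (expR y ^+ 4 * ((1 - y) ^+ 2 * (1 - 2 * y + 2 * y ^+ 2))).
  have -> : a ^+ 4 = a ^+ 2 * a ^+ 2 by rewrite -exprD.
  rewrite -[in LHS](mul1r (expR y ^+ 4)) -[1](expr1n _ 2)
    -[X in X ^+ 2 * expR y ^+ 4]h3.
  by rewrite exprMn; ring.
by rewrite -[X in _ <= X]mulr1 ler_pM2l ?exprn_gt0.
Qed.

Lemma fact_mul_expR_le (K : realType) (n : nat)
  : (n`!)%:R * expR n%:R <= n.+1%:R ^+ n.+1 :> K.
Proof.
elim: n => [|n IH]; first by rewrite fact0 expR0 mulr1 expr1.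
have h : expR 1 * n.+1%:R ^+ n.+2 <= n.+2%:R ^+ n.+2 :> K.
  have n2 : n.+2%:R != 0 :> K by rewrite pnatr_eq0.
  have e : expR 1 = expR (n.+2%:R^-1) ^+ n.+2 :> K by rewrite -expRM_natl mulfV.
  rewrite e -exprMn lerXn2r ?nnegrE ?mulr_ge0 ?expR_ge0 //.
  have := expR_ge1Dx (- (n.+2%:R^-1 : K)); rewrite expRN => H.
  rewrite -ler_pdivlMl ?expR_gt0 //; apply: le_trans (ler_wpM2r _ H) => //.
  by rewrite mulrDl mul1r mulNr mulVf // -[n.+2%:R]natr1 addrK.
rewrite factS natrM.
apply: le_trans h; rewrite [X in _ <= _ * X]exprS -[in X in expR X]natr1 expRD.
have -> : n.+1%:R * n`!%:R * (expR n%:R * expR 1) =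
  expR 1 * (n.+1%:R * (n`!%:R * expR n%:R)) :> K by ring.
by apply: ler_wpM2l; rewrite ?expR_ge0 // ler_wpM2l.
Qed.

Lemma exprn_le_expR_fact (K : realType) (n : nat)
  : n%:R ^+ n <= expR n%:R * (n`!)%:R :> K.
Proof.
elim: n => [|n IH]; first by rewrite fact0 expR0 mulr1 expr0.
have h : n.+1%:R ^+ n <= expR 1 * n%:R ^+ n :> K.
  case: n {IH} => [|n]; first
    by rewrite !expr0 mulr1 (le_trans _ (expR_ge1Dx _)) // lerDl.
  have n2 : n.+1%:R != 0 :> K by rewrite pnatr_eq0.
  have e : expR 1 = expR (n.+1%:R^-1) ^+ n.+1 :> K by rewrite -expRM_natl mulfV.
  rewrite e -exprMn lerXn2r ?nnegrE ?mulr_ge0 ?expR_ge0 //.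
  rewrite -ler_pdivrMr ?ltr0n //; apply: le_trans (expR_ge1Dx _).
  by rewrite -natr1 mulrDl divff // mul1r.
rewrite factS natrM -[in X in expR X]natr1 expRD exprS.
have -> : expR n%:R * expR 1 * (n.+1%:R * n`!%:R) =
  n.+1%:R * (expR 1 * (expR n%:R * n`!%:R)) :> K by ring.
apply: ler_wpM2l => //; apply: le_trans h _.
by apply: ler_wpM2l; rewrite ?expR_ge0.
Qed.

Lemma exp4_fact2_le n : (4 ^ n * n`! ^ 2 <= (n.*2.+1)`!)%N.
Proof.
elim: n => [|n IH] //; rewrite doubleS !factS expnS.
have -> : (4 * 4 ^ n * (n.+1 * n`!) ^ 2 = (2 * n.+1) * (2 * n.+1)
  * (4 ^ n * n`! ^ 2))%N.
  by ring.
rewrite [X in (_ <= X)%N]mulnA; apply: leq_mul IH.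
by apply: leq_mul; rewrite -addnn; lia.
Qed.

(** The quotient of factorials is a multinomial coefficient, close to its
upper bound m ^ (m (n + 1)); the two-sided estimates of n! by (n / e)^n lose a
factor e^m only. *)
Lemma multinomial_le (K : realType) (m n : nat) :
  m%:R ^+ (m * n.+1) * (n`!)%:R ^+ m <= 3 ^+ m * ((m * n.+1)`!)%:R :> K.
Proof.
have e0 (k : nat) : 0 < expR k%:R :> K by exact: expR_gt0.
rewrite -(@ler_pM2r _ (expR (m * n)%:R)) ?e0 //.
have h1 : (n`!)%:R ^+ m * expR (m * n)%:R <= n.+1%:R ^+ (m * n.+1) :> K.
  rewrite natrM expRM_natl -exprMn mulnC exprM lerXn2r ?nnegrE ?mulr_ge0
    ?exprn_ge0 ?expR_ge0 //.
  exact: fact_mul_expR_le.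
rewrite -mulrA; apply: le_trans (ler_wpM2l _ h1) _; first by rewrite exprn_ge0.
rewrite -exprMn -natrM; apply: le_trans (exprn_le_expR_fact _ _) _.
have -> : expR (m * n.+1)%:R = expR 1 ^+ m * expR (m * n)%:R :> K.
  by rewrite -expRM_natl mulr1 -expRD -natrD mulnS.
rewrite [X in _ <= X]mulrAC; apply: ler_wpM2r => //.
apply: ler_wpM2r; first exact: expR_ge0.
by apply: lerXn2r; rewrite ?nnegrE ?expR_ge0 ?expR1_le3.
Qed.

Lemma cube_mul_exp_le (K : realType) (n : nat) : (18 <= n)%N ->
  3 * n%:R ^+ 3 * 25 ^+ n <= 237 * (319 / 10) ^+ n :> K.
Proof.
move=> /subnK <-; move: (n - 18)%N => k; elim: k => [|k IH].
  by rewrite add0n !exprS expr0; lra.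
rewrite addSn; set j := (k + 18)%N in IH *.
have j18 : 18 <= j%:R :> K by rewrite (ler_nat _ 18) leq_addl.
rewrite -[j.+1%:R]natr1 2!(exprS _ j).
have h : (j%:R + 1) ^+ 3 * 25 <= 319 / 10 * (j%:R ^+ 3) :> K.
  have := mulr_ge0 (ler0n K j) (ler0n K j) => j2.
  have h1 : 18 * j%:R ^+ 2 <= j%:R ^+ 3 :> K
    by rewrite exprS ler_wpM2r ?exprn_ge0.
  have h2 : 18 * j%:R <= j%:R ^+ 2 :> K by rewrite expr2 ler_wpM2r.
  have -> : (j%:R + 1) ^+ 3 = j%:R ^+ 3 + 3 * j%:R ^+ 2 + 3 * j%:R + 1 :> K
    by ring.
  lra.
have p25 : 0 <= 25 ^+ j :> K by rewrite exprn_ge0.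
have := ler_wpM2r p25 h; move: IH.
move: (25 ^+ j) ((319 / 10) ^+ j) (j%:R ^+ 3) ((j%:R + 1) ^+ 3) => a b c d; lra.
Qed.

Lemma sqr_mul_exp_lt (K : realType) (n : nat) : (18 <= n)%N ->
  3 * n.+1%:R ^+ 2 * 3 ^+ n < (113 / 20) ^+ n :> K.
Proof.
move=> /subnK <-; move: (n - 18)%N => k; elim: k => [|k IH].
  by rewrite add0n !exprS expr0; lra.
rewrite addSn; set j := (k + 18).+1 in IH *.
have j18 : 18 <= j%:R :> K by rewrite (ler_nat _ 18) /j leqW // leq_addl.
rewrite -[j.+1%:R]natr1 2!(exprS _ (k + 18)).
have h : (j%:R + 1) ^+ 2 * 3 <= 113 / 20 * (j%:R ^+ 2) :> K.
  have h2 : 18 * j%:R <= j%:R ^+ 2 :> K by rewrite expr2 ler_wpM2r.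
  have -> : (j%:R + 1) ^+ 2 = j%:R ^+ 2 + 2 * j%:R + 1 :> K by ring.
  lra.
have p25 : 0 <= 3 ^+ (k + 18) :> K by rewrite exprn_ge0.
have := ler_wpM2r p25 h; move: IH.
move: (3 ^+ (k + 18)) ((113 / 20) ^+ (k + 18)) (j%:R ^+ 2) ((j%:R + 1) ^+ 2)
  => a b c d; lra.
Qed.

Lemma odd_le_exp3 m : (m.*2.+1 <= 3 ^ m)%N.
Proof. elim: m => // m IH; rewrite doubleS expnS; lia. Qed.

(** * The size of the auxiliary product against the factorials *)

(** Both sides are compared after dividing by y ^ (2 m n + n + m). The
dominant terms, of exponent m n, are 25 against (2 * 2.825)^2 > 31.9; the
powers of n and of m are absorbed by n >= 18. *)
Lemma exponent_comparison (K : realType) (m n : nat) (y : K)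
  : (3 <= m)%N -> (18 <= n)%N -> 0 < y ->
    113 / 20 * y <= 2 * m%:R ->
  y ^+ (2 * m * n + n + m) * 25 ^+ (m * n) * (n%:R ^+ 3 / 54) ^+ m * 3 ^+ n *
    3 ^+ m.*2.+1 * (m.*2.+1 * n.+1)%:R ^+ 2
  < m.*2.+1%:R ^+ (m.*2.+1 * n.+1) :> K.
Proof.
move=> m3 n18 y0 ym; set a : K := m.*2.+1%:R.
have a7 : 7 <= a by rewrite (ler_nat _ 7) ltnS (leq_double 3).
have ay : 113 / 20 * y <= a.
  by rewrite /a -[m.*2.+1%:R]natr1 -muln2 natrM; lra.
have a3 : a <= 3 ^+ m by rewrite -natrX ler_nat odd_le_exp3.
have gi := cube_mul_exp_le K n18; have gii := sqr_mul_exp_lt K n18.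
have SE : (m.*2.+1 * n.+1 = 2 * m * n + n + m + m.+1)%N by rewrite -mul2n; ring.
rewrite [X in _ < _ ^+ X]SE.
have bnd k : (113 / 20) ^+ k * y ^+ k <= a ^+ k.
  by rewrite -exprMn lerXn2r ?nnegrE //; lra.
apply: (@lt_le_trans _ _ ((113 / 20 * y) ^+ (2 * m * n + n + m) * a ^+ m.+1));
  last first.
  rewrite [X in _ <= X]exprD; apply: ler_wpM2r; first
    by rewrite exprn_ge0 // (le_trans _ a7).
  by rewrite exprMn bnd.
rewrite -!(mulrA (y ^+ _)) [(113 / 20 * y) ^+ _]exprMn.
rewrite [X in _ < X * _]mulrC -[X in _ < X]mulrA.
rewrite ltr_pM2l ?exprn_gt0 //.
set u : K := (319 / 10) ^+ n * (113 / 20) * a.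
have p319 : 0 < 319 / 10 :> K by lra.
have b0 : 0 < (319 / 10) ^+ n :> K by rewrite exprn_gt0.
have u0 : 0 < u by rewrite /u pmulr_rgt0 ?pmulr_rgt0 //; lra.
have lhs1 : 25 ^+ (m * n) * (n%:R ^+ 3 / 54) ^+ m * 9 ^+ m * 3 ^+ m <= u ^+ m.
  rewrite mulnC exprM -!exprMn.
  have c0 : 0 <= n%:R ^+ 3 * 25 ^+ n :> K by rewrite mulr_ge0 ?exprn_ge0.
  have E : 25 ^+ n * (n%:R ^+ 3 / 54)
    * 9 * 3 = 3 * n%:R ^+ 3 * 25 ^+ n / 6 :> K by field.
  have l0 : 0 <= 3 * n%:R ^+ 3 * 25 ^+ n / 6 :> K
    by rewrite !mulr_ge0 ?invr_ge0 ?exprn_ge0.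
  rewrite E; apply: lerXn2r; rewrite ?nnegrE ?l0 ?(ltW u0) //.
  have := ler_wpM2l (ltW b0) a7; move: gi b0; rewrite /u.
  move: ((319 / 10) ^+ n) (3 * n%:R ^+ 3 * 25 ^+ n) => b d. lra.
have um : u ^+ m <= (113 / 20) ^+ (2 * m * n) * (113 / 20) ^+ m * a ^+ m.
  rewrite /u exprMn [((319 / 10) ^+ n * _) ^+ m]exprMn; apply: ler_wpM2r;
    first by rewrite exprn_ge0 // (le_trans _ a7).
  have c0 (j : nat) : 0 <= (113 / 20) ^+ j :> K
    by rewrite exprn_ge0 // divr_ge0.
  apply: ler_wpM2r; first exact: c0.
  have -> : (319 / 10) ^+ n ^+ m = (319 / 10) ^+ (m * n) :> K
    by rewrite mulnC exprM.
  have -> : (113 / 20) ^+ (2 * m * n) = ((113 / 20) ^+ 2) ^+ (m * n) :> K.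
    by rewrite -exprM mulnA.
  apply: lerXn2r.
  - by rewrite nnegrE ltW.
  - by rewrite nnegrE sqr_ge0.
  by rewrite expr2; lra.
have am0 : 0 < a by lra.
have e3 : 0 < 3 ^+ m :> K by rewrite exprn_gt0.
rewrite -(ltr_pM2r e3).
have -> : 25 ^+ (m * n) * (n%:R ^+ 3 / 54) ^+ m * 3 ^+ n * 3 ^+ m.*2.+1 *
    (m.*2.+1 * n.+1)%:R ^+ 2 * 3 ^+ m =
  (25 ^+ (m * n) * (n%:R ^+ 3 / 54) ^+ m * 9 ^+ m * 3 ^+ m) *
  (3 * n.+1%:R ^+ 2 * 3 ^+ n * a * a) :> K.
  rewrite natrM -/a [3 ^+ m.*2.+1]exprS -mul2n [3 ^+ (2 * m)]exprM.
  have -> : 3 ^+ 2 = 9 :> K by ring.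
  move: (25 ^+ (m * n)) ((n%:R ^+ 3 / 54) ^+ m) (3 ^+ n) (3 ^+ m) (9 ^+ m) =>
    *; ring.
apply: (@le_lt_trans _ _ (u ^+ m * (3 * n.+1%:R ^+ 2 * 3 ^+ n * a * a))).
  apply: ler_wpM2r => //; rewrite !mulr_ge0 ?exprn_ge0 // ltW //.
apply: (@lt_le_trans _ _ (u ^+ m * ((113 / 20) ^+ n * a * a))).
  by rewrite ltr_pM2l ?exprn_gt0 // !ltr_pM2r.
have p1 : 0 <= (113 / 20) ^+ n * a * a
  by rewrite !mulr_ge0 ?exprn_ge0 ?(ltW am0) //; lra.
apply: le_trans (ler_wpM2r p1 um) _.
rewrite !exprD exprS.
have c0 (j : nat) : 0 <= (113 / 20) ^+ j :> K by rewrite exprn_ge0 //; lra.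
have := mulr_ge0 (mulr_ge0 (c0 (2 * m * n)%N) (c0 m))
  (mulr_ge0 (exprn_ge0 m (ltW am0)) (mulr_ge0 (c0 n) (ltW am0))).
move/ler_wpM2l => /(_ _ _ a3).
move: ((113 / 20) ^+ n) ((113 / 20) ^+ m) ((113 / 20) ^+ _) (a ^+ m) (3 ^+ m)
  => b c d e f H.
have -> : d * c * e * (b * a * a) = d * c * (e * (b * a)) * a by ring.
by apply: le_trans H _; rewrite le_eqVlt; apply/orP; left; apply/eqP; ring.
Qed.

(** A bound for |P_k(z)| when |k z| <= x. *)
Definition block_bound (K : realType) n (x : K) : K :=
  x * (n`!)%:R ^+ 2 * expR (4 * x).

Lemma prod_block_bound_le (K : realType) (J j n : nat) (B : K)
  : 0 <= B -> (j <= J)%N ->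
  \prod_(1 <= k < j.+1) block_bound n (k%:R * B) <=
  (J%:R * B * (n`!)%:R ^+ 2) ^+ j * expR (2 * B * (j%:R * j.+1%:R)).
Proof.
move=> B0; elim: j => [|j IH] jJ.
  by rewrite big_geq // expr0 mul0r mulr0 expR0 mulr1.
have f0 : 0 <= (n`!)%:R ^+ 2 :> K by rewrite exprn_ge0.
have kB k : 0 <= k%:R * B by rewrite mulr_ge0.
rewrite big_nat_recr //=.
have -> : expR (2 * B * (j.+1%:R * j.+2%:R)) =
    expR (2 * B * (j%:R * j.+1%:R)) * expR (4 * (j.+1%:R * B)).
  by rewrite -expRD -[j.+2%:R]natr1 -[j.+1%:R]natr1; congr expR; ring.
rewrite [(J%:R * B * _) ^+ j.+1]exprSr mulrACA.
apply: ler_pM.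
- by apply: prodr_ge0 => k _; rewrite !mulr_ge0 ?expR_ge0.
- by rewrite !mulr_ge0 ?expR_ge0.
- exact: IH (ltnW jJ).
apply: ler_wpM2r; first exact: expR_ge0.
by apply: ler_wpM2r => //; apply: ler_wpM2r; rewrite // ler_nat.
Qed.

(** As m B <= n / 6, the exponentials contribute at most exp ((5 / 3) m n +
n). *)
Lemma prod_block_bound2_le (K : realType) (m n : nat) (B : K) : 0 <= B ->
    6 * B * m%:R <= n%:R ->
  (\prod_(1 <= k < m.+1) block_bound n (k%:R * B)) *
  (\prod_(1 <= k < m.*2.+1) block_bound n (k%:R * B)) <=
  (n%:R ^+ 3 / 54) ^+ m * (n`!)%:R ^+ (6 * m) * ((25 / 4) ^+ (m * n) * 3 ^+ n).
Proof.
move=> B0 hB; have f0 : 0 <= (n`!)%:R ^+ 2 :> K by rewrite exprn_ge0.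
have bg0 j : 0 <= \prod_(1 <= k < j.+1) block_bound n (k%:R * B).
  by apply: prodr_ge0 => k _; rewrite !mulr_ge0 ?expR_ge0.
have h1 := @prod_block_bound_le K m m n B B0 (leqnn m).
have h2 := @prod_block_bound_le K m.*2 m.*2 n B B0 (leqnn _).
apply: le_trans (ler_pM (bg0 _) (bg0 _) h1 h2) _.
rewrite mulrACA -expRD; apply: ler_pM.
- by rewrite mulr_ge0 // exprn_ge0 // !mulr_ge0.
- exact: expR_ge0.
- rewrite -mul2n exprM -exprMn exprM -exprMn.
  apply: lerXn2r; rewrite ?nnegrE ?mulr_ge0 ?exprn_ge0 ?divr_ge0 //.
  have -> : m%:R * B * (n`!)%:R ^+ 2 * ((2 * m)%:R * B * (n`!)%:R ^+ 2) ^+ 2 =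
     (6 * B * m%:R) ^+ 3 / 54 * (n`!)%:R ^+ 6 :> K by rewrite natrM; field.
  apply: ler_wpM2r; first by rewrite exprn_ge0.
  apply: ler_wpM2r; first by rewrite invr_ge0.
  by apply: lerXn2r; rewrite ?nnegrE ?mulr_ge0.
apply: (@le_trans _ _ (expR ((m * n)%:R * (5 / 3) + n%:R * 1))).
  rewrite ler_expR -[m.*2.+1%:R]natr1 -[m.+1%:R]natr1 -mul2n !natrM.
  have -> : 2 * B * (m%:R * (m%:R + 1)) + 2 * B * (2 * m%:R * (2 * m%:R + 1)) =
    (6 * B * m%:R) * ((5 * m%:R + 3) / 3) :> K by field.
  have -> : m%:R * n%:R * (5 / 3) + n%:R * 1 = n%:R * ((5 * m%:R + 3) / 3)
    :> K by field.
  by apply: ler_wpM2r hB; rewrite divr_ge0 // addr_ge0 // mulr_ge0.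
rewrite expRD [expR ((m * n)%:R * _)]expRM_natl [expR (n%:R * 1)]expRM_natl.
apply: ler_pM; rewrite ?exprn_ge0 ?expR_ge0 //.
  by apply: lerXn2r; rewrite ?nnegrE ?expR_ge0 ?divr_ge0 ?expR53_le.
by apply: lerXn2r; rewrite ?nnegrE ?expR_ge0 ?expR1_le3.
Qed.

(** Here [L] is the common multiple of the binomial coefficients 'C(n, h), and
[q] is the leading coefficient times delta. *)
Lemma size_estimate (K : realType) (m n L : nat) (q B : K) :
    (3 <= m)%N -> (18 <= n)%N -> 0 < q -> 0 <= B ->
    113 / 20 * q ^+ 3 <= 2 * m%:R -> 6 * B * m%:R <= n%:R -> (L <= 4 ^ n)%N ->
  q ^+ (3 * (2 * m * n + n + m)) *
    (L%:R ^+ m.*2 * (n`!)%:R *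
     ((\prod_(1 <= k < m.+1) block_bound n (k%:R * B)) *
      (\prod_(1 <= k < m.*2.+1) block_bound n (k%:R * B)))) <
  (((m.*2.+1 * n.+1).-2)`! * (n`! ^ m.*2 * (n.*2.+1)`! ^ m))%N%:R.
Proof.
move=> m3 n18 q0 B0 hq hB hL.
set S := (m.*2.+1 * n.+1)%N; set Q := q ^+ _.
have Q0 : 0 < Q by rewrite exprn_gt0.
have fp : 0 < (n`!)%:R :> K by rewrite ltr0n fact_gt0.
set X := n%:R ^+ 3 / 54 : K.
have X0 : 0 <= X by rewrite divr_ge0 // exprn_ge0.
have core : Q * 25 ^+ (m * n) * X ^+ m * 3 ^+ n * 3 ^+ m.*2.+1 * S%:R ^+ 2 <
   m.*2.+1%:R ^+ S.
  by rewrite /Q exprM; apply: exponent_comparison; rewrite // exprn_gt0.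
have S2 : (1 < S)%N by rewrite /S; case: (m) m3 => // k _; lia.
have SS : (S`! <= S ^ 2 * (S.-2)`!)%N.
  case: (S) S2 => [|[|s]] // _;
    rewrite !factS mulnA leq_mul // -mulnn leq_mul //.
set f := (n`!)%:R : K in fp *.
have hL' : L%:R ^+ m.*2 <= 16 ^+ (m * n) :> K.
  have -> : 16 ^+ (m * n) = (4 ^ n)%:R ^+ m.*2 :> K.
    by rewrite natrX -exprM -mul2n mulnCA [4 ^+ (2 * _)]exprM [(n *
      m)%N]mulnC; congr (_ ^+ _); ring.
  by apply: lerXn2r; rewrite ?nnegrE // ler_nat.
have up : L%:R ^+ m.*2 * f * ((\prod_(1 <= k < m.+1) block_bound n (k%:R * B)) *
      (\prod_(1 <= k < m.*2.+1) block_bound n (k%:R * B))) <=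
    16 ^+ (m * n) * f * (X ^+ m * f ^+ (6 * m) * ((25 / 4) ^+ (m * n)
      * 3 ^+ n)).
  apply: ler_pM; rewrite ?mulr_ge0 ?exprn_ge0 ?(ltW fp) //.
  - by apply: prodr_ge0 => k _; rewrite !mulr_ge0 ?expR_ge0 ?exprn_ge0.
  - by apply: prodr_ge0 => k _; rewrite !mulr_ge0 ?expR_ge0 ?exprn_ge0.
  - by rewrite ler_wpM2r // ltW.
  - exact: prod_block_bound2_le.
have h4 : 4 ^+ (m * n) * f ^+ m.*2 <= (n.*2.+1)`!%:R ^+ m.
  have -> : 4 ^+ (m * n) * f ^+ m.*2 = (4 ^ n * n`! ^ 2)%:R ^+ m :> K.
    by rewrite natrM !natrX exprMn -!exprM mulnC mul2n.
  by apply: lerXn2r; rewrite ?nnegrE // ler_nat exp4_fact2_le.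
have mul := multinomial_le K m.*2.+1 n; rewrite -/S -/f in mul.
apply: le_lt_trans (ler_wpM2l (ltW Q0) up) _.
rewrite !natrM !natrX -/f.
apply: (@lt_le_trans _ _ ((S.-2)`!%:R * (f ^+ m.*2 * (4 ^+ (m * n)
  * f ^+ m.*2)))); last first.
  by rewrite !ler_wpM2l // exprn_ge0 // ltW.
have c0 : 0 < S%:R ^+ 2 * 3 ^+ m.*2.+1 :> K
  by rewrite mulr_gt0 ?exprn_gt0 // ltr0n ltnW.
(* Both sides are multiplied by S ^ 2 * 3 ^ (2 m + 1), for [multinomial_le]
   and S! <= S ^ 2 (S - 2)!. *)
rewrite -(ltr_pM2l c0).
have SK : (S`!)%:R <= S%:R ^+ 2 * (S.-2)`!%:R :> K
  by rewrite -natrX -natrM ler_nat.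
have g0 : 0 < f ^+ (4 * m) * 4 ^+ (m * n) by rewrite mulr_gt0 ?exprn_gt0.
apply: (@lt_le_trans _ _ (m.*2.+1%:R ^+ S * f ^+ m.*2.+1 * (f ^+ (4 * m)
  * 4 ^+ (m * n)))).
  have -> : S%:R ^+ 2 * 3 ^+ m.*2.+1 * (Q * (16 ^+ (m * n) * f *
     (X ^+ m * f ^+ (6 * m) * ((25 / 4) ^+ (m * n) * 3 ^+ n)))) =
    (Q * 25 ^+ (m * n) * X ^+ m * 3 ^+ n * 3 ^+ m.*2.+1 * S%:R ^+ 2) *
     f ^+ m.*2.+1 * (f ^+ (4 * m) * 4 ^+ (m * n)).
    have -> : 25 ^+ (m * n) = (25 / 4) ^+ (m * n) * 4 ^+ (m * n) :> K.
      by rewrite -exprMn; congr (_ ^+ _); field.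
    have -> : 16 ^+ (m * n) = 4 ^+ (m * n) * 4 ^+ (m * n) :> K.
      by rewrite -exprMn; congr (_ ^+ _); ring.
    have -> : f ^+ (6 * m) = f ^+ m.*2 * f ^+ (4 * m).
      by rewrite -exprD -mul2n -mulnDl.
    rewrite [f ^+ m.*2.+1]exprS.
    move: (4 ^+ (m * n)) ((25 / 4) ^+ (m * n)) (3 ^+ n) (3 ^+ m.*2.+1) (X ^+ m).
    move: (f ^+ m.*2) (f ^+ (4 * m)) => *; ring.
  by rewrite ltr_pM2r // ltr_pM2r ?exprn_gt0.
have -> : S%:R ^+ 2 * 3 ^+ m.*2.+1 * ((S.-2)`!%:R * (f ^+ m.*2 * (4 ^+ (m * n)
  * f ^+ m.*2))) =
   3 ^+ m.*2.+1 * (S%:R ^+ 2 * (S.-2)`!%:R) * (f ^+ (4 * m) * 4 ^+ (m * n)).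
  have -> : f ^+ (4 * m) = f ^+ m.*2 * f ^+ m.*2
    by rewrite -exprD -mul2n -mulnDl.
  by ring.
apply: ler_wpM2r; first exact: ltW.
apply: le_trans mul _; apply: ler_wpM2l => //; exact: exprn_ge0.
Qed.

(** * Prime powers at the bad primes *)

(** It suffices to test divisibility one prime at a time. *)
Lemma exp_part_dvd (W d N0 : nat) (pi : nat_pred) : (0 < W)%N ->
    (forall p, prime p -> (p %| W)%N -> p \notin pi ->
       (p ^ (logn p W * d) %| N0)%N) ->
  (W`_(pi^') ^ d %| N0)%N.
Proof.
move=> W0 H; apply/dvdn_partP; first by rewrite expn_gt0 part_gt0.
move=> p; rewrite mem_primes => /and3P[pp _ pd].
have pW : (p %| W`_(pi^'))%N.
  have [d0|d0] := posnP d; last by move: pd; rewrite Euclid_dvdX // d0 andbT.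
  by move: pd pp; rewrite d0 expn0 dvdn1 => /eqP ->.
have pi' : p \in pi^'.
  by have := part_pnat pi^' W; rewrite /pnat => /andP[_ /allP]; apply;
    rewrite mem_primes pp part_gt0.
have pW' := dvdn_trans pW (dvdn_part _ _).
apply: dvdn_trans (H p pp pW' pi').
rewrite p_part lognX mulnC dvdn_exp2l // leq_mul2r.
by rewrite dvdn_leq_log ?orbT // dvdn_part.
Qed.

Lemma big_primes (K : comNzRingType) (D m : nat) (F : nat -> K) : (D <= m)%N ->
  \prod_(p <- primes D) F p = \prod_(0 <= p < m.+1 | p \in primes D) F p.
Proof.
move=> Dm; rewrite -[RHS]big_filter; apply: perm_big; apply: uniq_perm.
- exact: primes_uniq.
- by rewrite filter_uniq // iota_uniq.
move=> p; rewrite mem_filter mem_index_iota /=.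
case E: (p \in primes D) => //=; move: E;
  rewrite mem_primes => /and3P[_ D0 /dvdn_leq].
by move=> /(_ D0) pD; rewrite ltnS (leq_trans pD Dm).
Qed.

(** Distinct primes that divide t have a product that divides t. *)
Lemma prod_prime_divisors_leq (t m : nat) (P : pred nat)
  : (0 < t)%N -> (t <= m)%N ->
  (forall p, P p -> prime p /\ (p %| t)%N) ->
  (\prod_(0 <= p < m.+1 | P p) p <= t)%N.
Proof.
move=> t0 tm HP; apply: dvdn_leq => //.
pose pi : nat_pred := [pred p | P p].
apply: (@dvdn_trans t`_pi); last exact: dvdn_part.
rewrite (widen_partn _ tm); elim/big_rec2: _ => // p a b Pp ab.
apply: dvdn_mul => //; have [pp pt] := HP p Pp.
by rewrite dvdn_exp // logn_gt0 mem_primes pp t0.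
Qed.

Lemma root_prime_power_ge (K : realType) (p v E : nat)
  : prime p -> (v * p.-1 <= E)%N ->
  (p ^ v)%:R <= (p%:R `^ (p%:R - 1)^-1) ^+ E :> K.
Proof.
move=> pp vE; have p1 : (1 < p)%N := prime_gt1 pp.
have p1K : 1 <= p%:R :> K by rewrite ler1n ltnW.
have pm0 : 0 < p%:R - 1 :> K by rewrite subr_gt0 ltr1n.
rewrite -powR_mulrn ?powR_ge0 // -powRrM natrX -powR_mulrn //.
apply: ler_powR => //; rewrite ler_pdivlMl //.
have -> : p%:R - 1 = p.-1%:R :> K by rewrite -subn1 natrB // ltnW.
by rewrite -natrM ler_nat mulnC.
Qed.

(** A prime divisor p of D contributes at most (p ^ (1 / (p - 1))) ^ E, a
factor of delta ^ E. The other bad primes divide r but not c, so their product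
divides r / c, and the crude exponent E is enough for them. *)
Lemma bad_primes_bound (K : realType) (W E r c D : nat) :
    (0 < W)%N -> (0 < r)%N -> (0 < D)%N -> (c %| r)%N -> (c %| D)%N ->
    (forall p, prime p -> (logn p W * p.-1 <= E)%N) ->
  (W`_([pred p | (p %| r) || (p %| D)] : nat_pred))%N%:R * c%:R ^+ E <=
  (r%:R * \prod_(p <- primes D) (p%:R `^ (p%:R - 1)^-1)) ^+ E :> K.
Proof.
move=> W0 r0 D0 /dvdnP[t rE] cD HE; set pi : nat_pred := [pred p | _].
have t0 : (0 < t)%N by case: t rE r0 => // ->.
have c0 : (0 < c)%N by case: c rE r0 {cD} => // ->; rewrite muln0.
pose m := (W + D + t)%N.
pose x (p : nat) : K := p%:R `^ (p%:R - 1)^-1.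
pose P (p : nat) := [&& prime p, (p %| r)%N & ~~ (p %| D)%N].
have Pt : (\prod_(0 <= p < m.+1 | P p) p <= t)%N.
  apply: prod_prime_divisors_leq => //; first by rewrite /m leq_addl.
  move=> p /and3P[pp pr pD]; split => //; move: pr;
    rewrite rE mulnC Gauss_dvdr //.
  by rewrite prime_coprime //; apply: contra pD => /dvdn_trans; apply.
have key : (W`_pi)%:R <=
    (\prod_(p <- primes D) x p) ^+ E * (\prod_(0 <= p < m.+1 | P p)
      p)%N%:R ^+ E :> K.
  have Wm : (W <= m)%N by rewrite /m -addnA leq_addr.
  have Dm : (D <= m)%N by rewrite /m addnAC leq_addl.
  rewrite (widen_partn _ Wm) (big_primes x Dm) !natr_prod -!prodrXl.
  rewrite big_mkcond [X in _ <= X * _]big_mkcond [X in _ <= _ * X]big_mkcond /=.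
  rewrite -big_split /=; apply: ler_prod => p _; apply/andP; split.
    by case: ifP.
  have x1 : prime p -> 1 <= x p ^+ E.
    by move=> pp; have := @root_prime_power_ge K p 0 E pp; apply.
  rewrite /pi inE /P mem_primes D0 /=; case pp : (prime p) => /=; last first.
    by rewrite lognE pp /= expn0 mulr1; case: ifP.
  case: (boolP (p %| D)%N) => pD;
    rewrite ?orbT ?orbF ?andbF ?andbT /= ?mulr1 ?mul1r.
    exact: root_prime_power_ge (HE p pp).
  case: ifP => _ //; rewrite -natrX ler_nat leq_exp2l ?prime_gt1 //.
  by apply: leq_trans (HE p pp);
    rewrite leq_pmulr // -ltnS prednK ?prime_gt0 ?prime_gt1.
have c0K : 0 <= c%:R ^+ E :> K by rewrite exprn_ge0.
apply: le_trans (ler_wpM2r c0K key) _.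
have -> : r%:R = t%:R * c%:R :> K by rewrite rE natrM.
have d0 : 0 <= \prod_(p <- primes D) x p
  by apply: prodr_ge0 => p _; rewrite powR_ge0.
rewrite -mulrA -!exprMn mulrC; apply: lerXn2r.
- by rewrite nnegrE !mulr_ge0.
- by rewrite nnegrE !mulr_ge0.
rewrite [X in X <= _]mulrA [X in X <= _]mulrC.
by apply: ler_wpM2r; rewrite ?mulr_ge0 ?ler_nat.
Qed.

Local Open Scope complex_scope.

(** * Archimedean size of the norm *)

(** Pairing t with - t halves the growth in z: z ^ 2 - t ^ 2 is at most |z| ^
2 + t ^ 2, far less than (|z| + t) ^ 2. *)
Lemma ring_block_pairs (A : comNzRingType) n (x : A) :
  ring_block n x = x * \prod_(1 <= t < n.+1) (x ^+ 2 - t%:R ^+ 2).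
Proof.
elim: n => [|n IH]; first
  by rewrite /ring_block big_ord1 big_geq // addr0 subr0 mulr1.
rewrite /ring_block doubleS big_ord_recl big_ord_recr /= [in RHS]big_nat_recr
  //= [RHS]mulrA -IH.
rewrite subr0 /bump /= !add1n.
have -> : x + n.+1%:R - n.*2.+2%:R = x - n.+1%:R.
  by rewrite -doubleS -addnn natrD opprD addrA addrK.
have -> : \prod_(i < n.*2.+1) (x + n.+1%:R - i.+1%:R) = ring_block n x.
  by apply: eq_bigr => i _; rewrite -[n.+1%:R]natr1 -[i.+1%:R]natr1; ring.
ring.
Qed.

Lemma norm_ring_block_le (K : realType) n (x : K[i]) (X : K) : 0 <= X ->
  `|x| <= X%:C -> `|ring_block n x| <= (block_bound n X)%:C.
Proof.
move=> X0 xX; rewrite ring_block_pairs normrM.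
have h : `|\prod_(1 <= t < n.+1) (x ^+ 2 - t%:R ^+ 2)| <=
   (\prod_(1 <= t < n.+1) (X ^+ 2 + t%:R ^+ 2))%:C.
  rewrite normr_prod rmorph_prod; apply: ler_prod => t _; rewrite normr_ge0 /=.
  apply: le_trans (ler_normB _ _) _; rewrite !normrX normr_nat.
  rewrite rmorphD !rmorphXn rmorph_nat lerD2r lerXn2r ?nnegrE //.
  by rewrite -(rmorph0 (real_complex K)) lecR.
have pE : \prod_(1 <= t < n.+1) (X ^+ 2 + t%:R ^+ 2) =
   n`!%:R ^+ 2 * \prod_(1 <= t < n.+1) (1 + X ^+ 2 / t%:R ^+ 2).
  rewrite fact_prod natr_prod -prodrXl -big_split /=.
  rewrite big_nat_cond [RHS]big_nat_cond; apply: eq_bigr => t.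
  rewrite andbT => /andP[t0 _]; field; by rewrite pnatr_eq0 -lt0n.
apply: (@le_trans _ _ (X%:C * (\prod_(1 <= t < n.+1) (X ^+ 2 + t%:R ^+ 2))%:C)).
  by apply: ler_pM.
rewrite -rmorphM lecR /block_bound -mulrA pE; apply: ler_wpM2l => //.
apply: ler_wpM2l; first by rewrite exprn_ge0.
exact: prod_1Dsqr_le.
Qed.

Lemma norm_aux_value_le (K : realType) L m n (z : K[i]) (B : K) : 0 <= B ->
  `|z| <= B%:C ->
  `|aux_value L m n z| <= (L%:R ^+ m.*2 * (n`!)%:R *
     ((\prod_(1 <= k < m.+1) block_bound n (k%:R * B)) *
      (\prod_(1 <= k < m.*2.+1) block_bound n (k%:R * B))))%:C.
Proof.
move=> B0 zB; rewrite /aux_value !normrM normrX !normr_nat !rmorphM rmorphXn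
  !rmorph_nat.
have H j : `|\prod_(1 <= k < j.+1) ring_block n (k%:R * z)| <=
    (\prod_(1 <= k < j.+1) block_bound n (k%:R * B))%:C.
  rewrite normr_prod rmorph_prod; apply: ler_prod => k _; rewrite normr_ge0 /=.
  apply: norm_ring_block_le; first by rewrite mulr_ge0.
  by rewrite normrM normr_nat rmorphM rmorph_nat ler_wpM2l.
by apply: ler_wpM2l; rewrite ?mulr_ge0 ?exprn_ge0 //; apply: ler_pM.
Qed.

Lemma complex_factorization (K : realType) (f : {poly int}) (B : K) :
    (1 < size f)%N ->
    (forall z : K[i], root (map_poly intr f) z -> `|z| <= B%:C) ->
  exists2 zs : seq K[i],
  (size zs = (size f).-1 /\ {in zs, forall z, `|z| <= B%:C}) &
  map_poly intr f = (lead_coef f)%:~R *: \prod_(z <- zs) ('X - z%:P).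
Proof.
move=> f1 roots_le.
have [zs E] := closed_field_poly_normal (map_poly intr f : {poly K[i]}).
have l0 : lead_coef (map_poly intr f : {poly K[i]}) = (lead_coef f)%:~R.
  by rewrite lead_coef_map_inj //; apply: intr_inj.
have f0 : f != 0 by rewrite -size_poly_gt0 ltnW.
have lf : (lead_coef f)%:~R != 0 :> K[i] by rewrite intr_eq0 lead_coef_eq0.
exists zs; last by rewrite {1}E l0.
split; last
  by move=> z zzs; apply: roots_le; rewrite E rootZ ?l0 // root_prod_XsubC.
have := congr1 (size \o (@polyseq _)) E; rewrite /= size_map_inj_poly //;
  last exact: intr_inj.
by rewrite size_scale ?l0 // size_prod_XsubC => ->.
Qed.

(** There is at least one root. *)
Lemma root_bound_ge0 (K : realType) (f : {poly int}) (B : K) :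
    (1 < size f)%N ->
    (forall z : K[i], root (map_poly intr f) z -> `|z| <= B%:C) ->
  0 <= B.
Proof.
move=> f1 roots_le; have [zs [szs zB] _] := complex_factorization f1 roots_le.
have : (0 < size zs)%N by rewrite szs; case: (size f) f1 => [|[]].
case: zs zB {szs} => // z zs zB _; rewrite -lecR.
exact: le_trans (normr_ge0 z) (zB z (mem_head _ _)).
Qed.

(** The constant coefficient is a nonzero integer, and up to sign it is the
leading coefficient times the product of the roots. *)
Lemma lead_mul_root_bound_ge1 (K : realType) (f : {poly int}) (B : K) :
    (1 < size f)%N ->
    (forall z : K[i], root (map_poly intr f) z -> `|z| <= B%:C) ->
  ~~ root f 0 -> 1 <= `|lead_coef f|%N%:R * B.
Proof.
move=> f1 roots_le f00.
have [zs [szs zB] E] := complex_factorization f1 roots_le.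
have B0 := root_bound_ge0 f1 roots_le.
have c1 : 1 <= `|lead_coef f|%N%:R :> K.
  by rewrite ler1n absz_gt0 lead_coef_eq0 -size_poly_gt0 ltnW.
have h : (`|f.[0]|%N%:R : K[i]) <= (`|lead_coef f|%N%:R * B ^+ size zs)%:C.
  have -> : `|f.[0]|%N%:R = `|(f.[0])%:~R| :> K[i].
    by rewrite -intr_norm -abszE.
  rewrite -horner_map rmorph0 E hornerZ normrM rmorphM rmorph_nat rmorphXn /=.
  rewrite -intr_norm -abszE; apply: ler_wpM2l => //.
  rewrite horner_prod normr_prod; elim: zs zB {szs E} => [|z zs IH] zB.
    by rewrite big_nil expr0.
  rewrite big_cons exprS; apply: ler_pM => //; last first.
  - by apply: IH => y ys; apply: zB; rewrite inE ys orbT.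
  - by rewrite hornerXsubC sub0r normrN zB ?mem_head.
  - by apply: prodr_ge0.
have h1 : 1 <= `|lead_coef f|%N%:R * B ^+ size zs.
  rewrite -lecR rmorph1; apply: le_trans h.
  by rewrite ler1n absz_gt0.
have n0 : (0 < size zs)%N by rewrite szs; case: (size f) f1 => [|[]].
have : 1 <= (`|lead_coef f|%N%:R * B) ^+ size zs.
  apply: le_trans h1 _; rewrite exprMn; apply: ler_wpM2r;
    first exact: exprn_ge0.
  by rewrite -{1}[_%:R]expr1 ler_weXn2l.
by rewrite -[X in X <= _ -> _](expr1n _ (size zs)) ler_pXn2r ?nnegrE ?mulr_ge0.
Qed.

(** The leading coefficient occurs in the norm only once for each linear
factor; the exponent is enlarged to make the bound a d-th power. *)
Lemma norm_aux_norm_le (K : realType) (f : {poly int}) (B : K) L m n :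
    (1 < size f)%N ->
    (forall z : K[i], root (map_poly intr f) z -> `|z| <= B%:C) ->
  `|aux_norm L m n (size f).-1 f|%N%:R <=
  (`|lead_coef f|%N%:R ^+ (n.*2.+1 * (m + m.*2)) *
    (L%:R ^+ m.*2 * (n`!)%:R *
     ((\prod_(1 <= k < m.+1) block_bound n (k%:R * B)) *
      (\prod_(1 <= k < m.*2.+1) block_bound n (k%:R * B))))) ^+ (size f).-1.
Proof.
move=> f1 roots_le; have [zs [szs zB] E] := complex_factorization f1 roots_le.
have B0 := root_bound_ge0 f1 roots_le.
rewrite -lecR rmorph_nat; set N0 := aux_norm _ _ _ _ _.
have -> : `|N0|%N%:R = `|N0%:~R| :> K[i] by rewrite -intr_norm -abszE.
rewrite aux_norm_map E -szs aux_norm_prod_XsubC !normrM !normrX normrM normrX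
  normrN1.
rewrite expr1n mul1r -intr_norm -abszE normr_prod.
set U := L%:R ^+ _ * _ * _; set e := (_ * _)%N; set c := `|lead_coef f|%N.
have U0 : 0 <= U.
  have bb j : 0 <= \prod_(1 <= k < j.+1) block_bound n (k%:R * B).
    by apply: prodr_ge0 => k _; rewrite !mulr_ge0 ?expR_ge0 ?exprn_ge0.
  by rewrite !mulr_ge0 ?exprn_ge0.
have h : \prod_(z <- zs) `|aux_value L m n z| <= (U ^+ size zs)%:C.
  elim: zs zB {szs E} => [|z zs IH] zB; first by rewrite big_nil expr0.
  rewrite big_cons exprS rmorphM; apply: ler_pM => //; last first.
  - by apply: IH => y ys; apply: zB; rewrite inE ys orbT.
  - by apply: norm_aux_value_le; rewrite // zB ?mem_head.
  - by apply: prodr_ge0.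
have n0 : (0 < size zs)%N by rewrite szs; case: (size f) f1 => [|[]].
have c1 : 1 <= c%:R :> K.
  by rewrite ler1n absz_gt0 lead_coef_eq0 -size_poly_gt0 ltnW.
apply: (@le_trans _ _ (c%:R ^+ e * (U ^+ size zs)%:C)).
  by apply: ler_wpM2l; rewrite ?exprn_ge0.
have -> : c%:R ^+ e = (c%:R ^+ e)%:C :> K[i] by rewrite rmorphXn rmorph_nat.
rewrite -rmorphM lecR [(c%:R ^+ e * U) ^+ _]exprMn; apply: ler_wpM2r;
  first exact: exprn_ge0.
by rewrite -[X in X <= _]expr1 ler_weXn2l // exprn_ege1.
Qed.

(** * The splitting criterion *)

(** Each factor of the norm is a power of k times the value of f at a rational
number (t - n) / k. *)
Lemma aux_norm_neq0 L m n (f : {poly int}) : (0 < L)%N -> f != 0 ->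
  (forall x : rat, ~~ root (map_poly intr f) x) ->
  aux_norm L m n (size f).-1 f != 0.
Proof.
move=> L0 f0 nr; have H k i : (0 < k)%N ->
    homogenization (size f).-1 f k%:R (i%:R - n%:R) != 0.
  move=> k0; have kz : (k%:R : int)%:~R != 0 :> rat
    by rewrite rmorph_nat pnatr_eq0 -lt0n.
  rewrite -(@intr_eq0 rat) homogenization_map homogenization_horner //.
    by rewrite mulf_neq0 ?expf_neq0 //; apply: nr.
  by rewrite size_map_inj_poly ?prednK ?size_poly_gt0 //; apply: intr_inj.
have Hk j : \prod_(1 <= k < j.+1) \prod_(i < n.*2.+1)
    homogenization (size f).-1 f k%:R (i%:R - n%:R) != 0.
  rewrite prodf_seq_neq0; apply/allP => k;
    rewrite mem_index_iota => /andP[k0 _].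
  by apply/prodf_neq0 => i _; apply: H.
rewrite /aux_norm !mulf_neq0 // expf_neq0 // mulf_neq0 //.
  by rewrite expf_neq0 // pnatr_eq0 -lt0n.
Qed.

Lemma splits_dvdp (F : fieldType) (P Q : {poly F}) :
  P %| Q -> splits Q -> splits P.
Proof.
move=> PQ [rs Qrs]; have : P %| \prod_(z <- rs) ('X - z%:P)
  by rewrite -(eqp_dvdr _ Qrs).
by case/dvdp_prod_XsubC => k Pk; exists (mask k rs).
Qed.

Lemma prime_dvd_fact p k : prime p -> (p %| k`!)%N -> (p <= k)%N.
Proof.
move=> pp; rewrite leqNgt; apply: contraL => kp.
have := logn_fact_trunc (m := 0) pp kp; rewrite big_geq // => /eqP.
by rewrite -leqn0 leqNgt logn_gt0 mem_primes pp fact_gt0.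
Qed.

Lemma node_count_bounds m n (S := (m.*2.+1 * n.+1)%N)
  : (3 <= m)%N -> (18 <= n)%N ->
  [/\ (S.-2 < S.-1)%N, (n <= S.-2)%N & (n.*2.+1 <= S.-2)%N].
Proof.
move=> m3 n18; have mn : (6 * n <= 2 * m * n)%N by apply: leq_mul => //; lia.
have -> : (S = (2 * m * n + n + 2 * m).+1)%N by rewrite /S -mul2n; ring.
rewrite -mul2n; move: (2 * m * n)%N mn => k; split; lia.
Qed.

Lemma weight_leq m n :
  ((m.*2.+1 * n.+1).-2 + (m.*2 * n + m * n.*2.+1) <= 3 * (2 * m * n + n + m))%N.
Proof.
rewrite -!mul2n.
have -> : ((2 * m).+1 * n.+1 = (2 * m * n + n + 2 * m).+1)%N by ring.
have -> : (3 * (2 * m * n + n + m) =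
  (2 * m * n + n + 2 * m) + (2 * m * n + m * (2 * n).+1) + 2 * n)%N by ring.
by apply: leq_trans (leq_addr _ _); rewrite leq_add2r leq_pred.
Qed.

(** The prime-to-bad part V of the factorials W satisfies V ^ d <= |norm| by
divisibility and |norm| <= (c ^ e U) ^ d by size, where U bounds the auxiliary
values. Multiplying V <= c ^ e U by the bad part of W gives W <= q ^ E U,
against [size_estimate]. *)
Lemma splitting_contradiction (K : realType) (R R0 f : {poly int}) (B : K)
  (m n : nat) :
  R != 0 -> is_squarefree_part R0 R ->
  (forall z : K[i], root (map_poly intr R) z -> `|z| <= B%:C) ->
  zpoly_dvd f R0 -> (2 < size f)%N ->
  (forall x : rat, ~~ root (map_poly intr f) x) ->
  let r := `|lead_coef R|%N in
  let S := (m.*2.+1 * n.+1)%N in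
  (3 <= m)%N -> (18 <= n)%N ->
  113 / 20 * (r%:R * delta K (resultant R0 R0^`())) ^+ 3 <= 2 * m%:R ->
  6 * B * m%:R <= n%:R ->
  (forall p : nat, prime p -> ~~ (p %| r)%N -> (p < S.-1)%N ->
     splits (map_poly intr R : {poly 'F_p})) ->
  False.
Proof.
move=> Rn0 sR roots_le fR0 sf nr r S m3 n18 hm hn Hsplit.
have [G _ RE] := sR; have [g R0E] := fR0.
have f0 : f != 0 by rewrite -size_poly_gt0 (ltn_trans _ sf).
have R0n0 : R0 != 0 by apply: contraNneq Rn0 => R00; rewrite RE R00 mul0r.
have sR0 : (2 < size R0)%N.
  apply: leq_trans sf _; have := R0n0;
    rewrite R0E mulf_eq0 negb_or => /andP[g0 _].
  rewrite size_mul //; move: g0; rewrite -size_poly_gt0;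
    case: (size g) => // k _.
  by rewrite addSn /= leq_addl.
set D := `|resultant R0 R0^`()|%N; set c := `|lead_coef f|%N;
  set d := (size f).-1.
have D0 : (0 < D)%N by rewrite absz_gt0 (squarefree_part_resultant_neq0 Rn0 sR).
have r0 : (0 < r)%N by rewrite absz_gt0 lead_coef_eq0.
have cl : (c %| `|lead_coef R0|)%N by rewrite R0E lead_coefM abszM dvdn_mull.
have cr : (c %| r)%N.
  by apply: dvdn_trans cl _; rewrite /r RE lead_coefM abszM dvdn_mulr.
have cD : (c %| D)%N.
  apply: dvdn_trans cl _; have := lead_coef_dvd_resultant (ltnW sR0).
  by rewrite dvdzE.
have c0 : (0 < c)%N by rewrite absz_gt0 lead_coef_eq0.
have roots_f z : root (map_poly intr f : {poly K[i]}) z -> `|z| <= B%:C.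
  by move=> fz; apply: roots_le; rewrite RE R0E !rmorphM !rootM fz orbT.
have f1 : (1 < size f)%N := ltnW sf.
have B0 := root_bound_ge0 f1 roots_f.
have [L /andP[L0 L4] HL] := bin_common_multiple n.
(* S - 1 is sigma: the divisor of the values at integers is lowered from
   sigma! T to (sigma - 1)! T, so that its primes lie below sigma. *)
pose T := (n`! ^ m.*2 * (n.*2.+1)`! ^ m)%N; pose W := ((S.-2)`! * T)%N.
have T0 : (0 < T)%N by rewrite muln_gt0 !expn_gt0 !fact_gt0.
have W0 : (0 < W)%N by rewrite muln_gt0 fact_gt0.
set N0 := aux_norm L m n d f.
have N00 : N0 != 0 by apply: aux_norm_neq0.
pose pi : nat_pred := [pred p | (p %| r)%N || (p %| D)%N].
have [S1 S2 S3] := node_count_bounds m3 n18; rewrite -/S in S1 S2 S3.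
have n0 : (0 < n)%N by apply: leq_trans n18.
have WN : (W`_(pi^') ^ d %| `|N0|)%N.
  apply: exp_part_dvd => // p pp pW; rewrite negb_or => /andP[pr pD].
  have fR : map_poly intr f %| (map_poly intr R : {poly 'F_p}).
    by rewrite RE R0E !rmorphM dvdp_mulr // dvdp_mulIr.
  have pS : (p < S.-1)%N.
    have H k : (p %| k`!)%N -> (k <= S.-2)%N -> (p < S.-1)%N.
      by move=> /(prime_dvd_fact pp) pk kS;
        apply: leq_ltn_trans (leq_trans pk kS) S1.
    move: pW; rewrite /W /T !Euclid_dvdM //.
    have exp x y : (p %| x ^ y)%N -> (p %| x)%N
      by rewrite Euclid_dvdX // => /andP[].
    by move=> /or3P[/H|/exp/H|/exp/H]; apply.
  have pc : ~~ (p %| lead_coef f)%Z.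
    by rewrite dvdzE; apply: contra pr => /dvdn_trans; apply.
  have := @pexp_dvd_aux_norm f p (logn p W)
    L m n pp pc (splits_dvdp fR (Hsplit p pp pr pS)).
  rewrite dvdzE; apply.
    by apply: separable_mod_prime fR0.
  move=> b nb; apply: dvdn_trans (pfactor_dvdnn p W) _.
  apply: dvdn_trans (fact_dvd_blocks m nb HL); apply: dvdn_mul => //.
  by rewrite -(bin_fact (ltnW S1)) dvdn_mull // dvdn_mulr.
set q := r%:R * _ in hm.
(* e is the degree of the auxiliary product, hence the exponent of c in the
   norm; E bounds both e and p - 1 times the valuation of W at every prime p.
   *)
pose E := (3 * (2 * m * n + n + m))%N; pose e := (n.*2.+1 * (m + m.*2))%N.
pose U : K := L%:R ^+ m.*2 * (n`!)%:R *
     ((\prod_(1 <= k < m.+1) block_bound n (k%:R * B)) *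
      (\prod_(1 <= k < m.*2.+1) block_bound n (k%:R * B))).
have U0 : 0 <= U.
  have bb j : 0 <= \prod_(1 <= k < j.+1) block_bound n (k%:R * B).
    by apply: prodr_ge0 => k _; rewrite !mulr_ge0 ?expR_ge0 ?exprn_ge0.
  by rewrite !mulr_ge0 ?exprn_ge0.
have key : (W`_(pi^'))%N%:R <= c%:R ^+ e * U :> K.
  have d0 : (0 < d)%N by rewrite /d; case: (size f) f1 => [|[]].
  have cU0 : 0 <= c%:R ^+ e * U by apply: mulr_ge0 U0; apply: exprn_ge0.
  rewrite -(ler_pXn2r d0) ?nnegrE //.
  apply: le_trans (norm_aux_norm_le L m n f1 roots_f).
  by rewrite -natrX ler_nat dvdn_leq // absz_gt0.
have logW p : prime p -> (logn p W * p.-1 <= E)%N.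
  move=> pp; have lf k := logn_fact_leq k pp.
  rewrite /W /T !lognM ?muln_gt0 ?expn_gt0 ?fact_gt0 // !lognX.
  have h1 := lf S.-2; have h2 := lf n; have h3 := lf n.*2.+1.
  have h2' : (m.*2 * logn p n`! * p.-1 <= m.*2 * n)%N
    by rewrite -mulnA leq_mul2l h2 orbT.
  have h3' : (m * logn p (n.*2.+1)`! * p.-1 <= m * n.*2.+1)%N
    by rewrite -mulnA leq_mul2l h3 orbT.
  rewrite !mulnDl; apply: leq_trans (leq_add h1 (leq_add h2' h3')) _.
  exact: weight_leq.
have bad := @bad_primes_bound K W E r c D W0 r0 D0 cr cD logW.
have q0 : 0 < q.
  rewrite mulr_gt0 ?ltr0n // /delta big_seq; apply: prodr_gt0 => p.
  by rewrite mem_primes => /andP[pp _]; rewrite powR_gt0 // ltr0n prime_gt0.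
have := @size_estimate K m n L q B m3 n18 q0 B0 hm hn L4.
rewrite -/E -/U -/S -/T -/W ltNge => /negP[].
have c1 : 1 <= c%:R :> K by rewrite ler1n.
have eE : (e <= E)%N.
  rewrite /e /E -!mul2n.
  have -> : (3 * (2 * m * n + n + m) = (2 * n).+1 * (m + 2 * m) + 3 * n)%N
    by ring.
  exact: leq_addr.
have cee : c%:R ^+ e <= c%:R ^+ E :> K by rewrite ler_weXn2l.
have Wp : W%:R = (W`_pi)%N%:R * (W`_(pi^'))%N%:R :> K by rewrite -natrM partnC.
rewrite Wp; apply: le_trans (ler_wpM2l (ler0n _ _) key) _.
rewrite mulrA; apply: ler_wpM2r => //; apply: le_trans bad.
by apply: ler_wpM2l.
Qed.

Lemma delta_ge1 (K : realType) (D : int) : 1 <= delta K D.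
Proof.
rewrite /delta big_seq; elim/big_rec: _ => // p x pD x1.
have pp : prime p by move: pD; rewrite mem_primes => /andP[].
rewrite -[X in X <= _]mulr1; apply: ler_pM => //.
by have := @root_prime_power_ge K p 0 1 pp isT; rewrite expn0 expr1.
Qed.

(** The constants 2.826 and 6.076 enter the proof only through these bounds.
*)
Lemma ceiling_bounds (K : realType) (X B M N : K) :
    1 <= X -> 0 <= B -> 1 <= B * X ->
    2826 / 1000 * X <= M -> 6076 / 1000 * B * M <= N ->
  [/\ 2 < M, 17 < N, 113 / 20 * X <= 2 * M & 6 * B * M <= N].
Proof.
move=> X1 B0 BX XM BN; have M2 : 2 < M by lra.
have BXM := ler_wpM2l B0 XM.
have BM0 : 0 <= B * M by apply: mulr_ge0 => //; lra.
by split => //; lra.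
Qed.

Lemma sigma_node_count (m n : nat) :
  (2 * m%:Z + 1) * n%:Z + 2 * m%:Z = ((m.*2.+1 * n.+1).-1)%N%:Z.
Proof.
have -> : (m.*2.+1 * n.+1 = ((2 * m + 1) * n + 2 * m).+1)%N
  by rewrite -mul2n; ring.
by rewrite /= PoszD !PoszM PoszD PoszM.
Qed.

Theorem theorem1p2 (K : realType) (R R0 : {poly int}) (B : K)
    (lead_gt0 : 0 < lead_coef R)
    (R0_sqf : is_squarefree_part R0 R)
    (roots_le : forall z : K[i], root (map_poly intr R) z -> `|z| <= B%:C) :
  let rn : int := lead_coef R in
  let DeltaR : int := resultant R0 R0^`() in
  let M : int :=
    Num.ceil (2826 / 1000 * rn%:~R ^+ 3 * delta K DeltaR ^+ 3) in
  let N : int := Num.ceil (6076 / 1000 * B * M%:~R) in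
  let sigma : int := (2 * M + 1) * N + 2 * M in
  splits (map_poly intr R : {poly rat})
  <->
  (forall p : nat, prime p -> ~~ (p%:Z %| rn)%Z -> p%:Z < sigma ->
     splits (map_poly intr R : {poly 'F_p})).
Proof.
move=> rn DeltaR M N sigma.
have Rn0 : R != 0 by rewrite -lead_coef_eq0 gt_eqF.
split=> [sQ p pp prn _|H].
  have [[c [s RE]]|[f [fR sf nr]]] := linear_factors_or_no_root Rn0.
    move: prn; rewrite /rn RE (dvdz_pcharf (pchar_Fp pp)).
    exact: splits_linear_factors.
  by case: (no_root_not_splits fR sf nr).
have [G _ RE] := R0_sqf.
have R0n0 : R0 != 0 by apply: contraNneq Rn0 => R00; rewrite RE R00 mul0r.
have [[c [s R0E]]|[f [fR0 sf nr]]] := linear_factors_or_no_root R0n0.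
  apply: (splits_of_squarefree_part Rn0 R0_sqf); rewrite R0E.
  by apply: splits_linear_factors; rewrite intr_eq0 lead_coef_eq0 -R0E.
exfalso; have [g R0E] := fR0.
set r := `|lead_coef R|%N.
have rE : rn = r :> int by rewrite /r gez0_abs // ltW.
have r1 : (0 < r)%N by rewrite absz_gt0 lead_coef_eq0.
have r1K : 1 <= r%:R :> K by rewrite ler1n.
have d1 := delta_ge1 K DeltaR.
have roots_f (z : K[i]) : root (map_poly intr f) z -> `|z| <= B%:C.
  by move=> fz; apply: roots_le; rewrite RE R0E !rmorphM !rootM fz orbT.
have f1 := ltnW sf; have B0 := root_bound_ge0 f1 roots_f.
have f00 : ~~ root f 0.
  by have := nr 0; rewrite -[0 in X in X -> _](rmorph0 (intr : int -> rat))
    rootE horner_map intr_eq0.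
have rB : 1 <= r%:R * B.
  apply: le_trans (lead_mul_root_bound_ge1 f1 roots_f f00) _.
  apply: ler_wpM2r => //; rewrite ler_nat dvdn_leq //.
  by rewrite /r RE R0E !lead_coefM !abszM mulnAC dvdn_mull.
set X : K := (r%:R * delta K DeltaR) ^+ 3.
have q1 : 1 <= r%:R * delta K DeltaR
  by rewrite -[X in X <= _]mulr1; apply: ler_pM.
have X1 : 1 <= X by apply: exprn_ege1.
have rX : r%:R <= X.
  apply: (@le_trans _ _ (r%:R * delta K DeltaR)); first by rewrite ler_peMr.
  by rewrite -[X in X <= _]expr1 ler_weXn2l.
have BX : 1 <= B * X.
  by apply: le_trans rB _; rewrite mulrC; apply: ler_wpM2l.
have XM : 2826 / 1000 * X <= M%:~R.
  by apply: le_trans (Num.Theory.ceil_ge _);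
    rewrite rE -[X in _ <= X]mulrA -exprMn.
have BN : 6076 / 1000 * B * M%:~R <= N%:~R by exact: Num.Theory.ceil_ge.
have [M2 N17 XM2 BM6] := ceiling_bounds X1 B0 BX XM BN.
have {}M2 : 2%:Z < M by rewrite -(ltr_int K).
have {}N17 : 17%:Z < N by rewrite -(ltr_int K).
have mE : M = `|M|%N :> int by rewrite gez0_abs // ltW // (lt_trans _ M2).
have nE : N = `|N|%N :> int by rewrite gez0_abs // ltW // (lt_trans _ N17).
have MK : M%:~R = `|M|%N%:R :> K by rewrite {1}mE.
have NK : N%:~R = `|N|%N%:R :> K by rewrite {1}nE.
apply: (@splitting_contradiction K R R0 f B `|M|%N `|N|%N) => //.
- by move: M2; rewrite {1}mE ltz_nat.
- by move: N17; rewrite {1}nE ltz_nat.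
- by rewrite -MK.
- by rewrite -MK -NK.
move=> p pp pr pS; apply: H => //.
by rewrite /sigma mE nE sigma_node_count ltz_nat.
Qed.
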